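(* Let $A(z)=A_0+A_1z+A_2z^2+\dots$ be an invertible formal power series with values in complex $N\times N$ matrices, let $\Psi^\pm(t,z)=\sum_{k\ge0}\Psi^\pm_k(A)z^k$, $t=(t^1,\dots,t^N)$, be the associated matrix series (twisted wave functions of the multi-component KP hierarchy), and let $$M_{a,b}(A(z)):=\sum_{i=0}^b(-1)^{b-i}\,\Psi^-_{a+b+1-i}\Psi^+_i,\qquad a,b\ge0,$$ be the associated tower. For a formal power series of matrices $r(z)=r_1z+r_2z^2+\dots$ put $$r(z).M_{a,b}(A(z)):=\left.\frac{\partial}{\partial\epsilon}M_{a,b}\bigl(A(z)\exp(\epsilon r(z))\bigr)\right|_{\epsilon=0}.$$ Then the formulas for this Lie algebra action coincide with the formulas of the $\mathfrak g_+$-action on matrix Gromov-Witten potentials up to a change of sign: for each $\ell\ge1$ there is a sign $\varepsilon_\ell\in\{1,-1\}$, depending only on $\ell$, such that for every matrix $r_\ell$ and all $a,b\ge0$ $$(r_\ell z^\ell).M_{a,b}=\varepsilon_\ell\Bigl[r_\ell M_{a+\ell,b}-(-1)^\ell M_{a,b+\ell}r_\ell+\sum_{i+j=\ell-1}(-1)^{i+1}M_{a,i}\,r_\ell\,M_{j,b}\Bigr].$$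
   Context: Definition of $\Psi^\pm$. Let $V^\pm(0,x,z)$ be the wave functions of the $N$-component KP hierarchy corresponding to the vector $A(z)|0\rangle$; then $\Psi^+(t,z)=V^+(0,x,z)A(z)$ and $\Psi^-(t,z)=A^{-1}(z)V^-(0,x,z)$, restricted to $x_1=t$, $x_{\ge2}=0$. Concretely, in formal terms, $\Psi^+$ is given by the Birkhoff factorization: there are unique $P(t,z)=\mathrm{id}+\sum_{k\ge1}P_k(t)z^{-k}$ and $\Psi^+(t,z)=\sum_{k\ge0}\Psi_k^+(t)z^k$ (coefficients being matrices of formal power series in $t$; the coefficient of each monomial in $t$ in $\Psi^+$ is a polynomial in $z$) with $$\Psi^+(t,z)=P(t,z)\,\exp\bigl(z\,\mathrm{diag}(t^1,\dots,t^N)\bigr)\,A(z^{-1}),$$ where $A(z^{-1})=A_0+A_1z^{-1}+\dots$ and $A_0$ is invertible; and $\Psi^-(t,z)$ is defined by $\Psi^-(t,-z)\Psi^+(t,z)=\mathrm{id}$. These series satisfy $\frac{\partial}{\partial t^k}\Psi^+=(zE_{kk}+W_k)\Psi^+$, where $E_{kk}$ is the matrix with $1$ in the $k$-th diagonal entry and zeroes elsewhere and $W_k=W_k(t)$ does not depend on $z$. With $r(z).\Psi_k^+:=\frac{\partial}{\partial\epsilon}\Psi_k^+(A(z)\exp(\epsilon r(z)))|_{\epsilon=0}$ one has the known formula $(r_\ell z^\ell).\Psi^+_k=\Psi^+_{\ell+k}r_\ell-\sum_{i=1}^\ell\sum_{j=0}^{\ell-i}(-1)^{\ell-i-j}\Psi^+_jr_\ell\Psi^-_{\ell-i-j}\Psi^+_{i+k}$.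 The $\mathfrak g_+$-action on matrix Gromov-Witten potentials referred to is $(r.M)_{a,b}=\sum_{l\ge1}[r_lM_{a+l,b}-(-1)^lM_{a,b+l}r_l+\sum_{i+j=l-1}(-1)^{i+1}M_{a,i}r_lM_{j,b}]$ for $r=\sum_{l\ge1}r_lz^l$. *)

(* Defs.v *)
From HB Require Import structures.
From mathcomp Require Import all_boot all_order all_algebra.
From mathcomp Require Import complex.
From mathcomp Require Import all_classical all_reals all_analysis.
Set Implicit Arguments.
Unset Strict Implicit.
Unset Printing Implicit Defensive.
Import Order.TTheory GRing.Theory Num.Theory.
Import numFieldNormedType.Exports.
Local Open Scope ring_scope.

(* t^m, for t = (t^1, ..., t^N), is represented by its exponent vector. *)
Definition mono (N : nat) := {ffun 'I_N -> nat}.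

Definition mdeg (N : nat) (m : mono N) : nat := \sum_(i < N) m i.

(* Formal power series in t^1, ..., t^N with coefficients in R.  A record, and
   not a bare function type, so that its product is not the pointwise one. *)
Record fps (N : nat) (R : Type) := FPS { coef : mono N -> R }.

HB.instance Definition _ N R := gen_eqMixin (fps N R).
HB.instance Definition _ N R := gen_choiceMixin (fps N R).

Lemma fpsP N R (f g : fps N R) : coef f =1 coef g <-> f = g.
Proof.
split=> [|->] //; case: f g => [f] [g] /= fg; congr FPS; exact: funext.
Qed.

Section Monomials.
Variable N : nat.
Implicit Types m : mono N.

Definition box (B : nat) := {ffun 'I_N -> 'I_B.+1}.

Definition boxm B (k : box B) : mono N := [ffun i => k i : nat].

Definition tobox B m : box B := [ffun i => inord (m i)].

Lemma boxm_inj B : injective (@boxm B).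
Proof.
by move=> k l /ffunP kl; apply/ffunP => i; apply/val_inj; have:= kl i; rewrite !ffunE.
Qed.

Lemma monoDE m1 m2 i : (m1 + m2) i = (m1 i + m2 i)%N.
Proof. by rewrite ffunE. Qed.

Lemma le_mdeg m i : (m i <= mdeg m)%N.
Proof. by rewrite /mdeg (bigD1 i) //= leq_addr. Qed.

Lemma toboxK B m : (forall i, m i <= B)%N -> boxm (tobox B m) = m.
Proof. by move=> mB; apply/ffunP => i; rewrite !ffunE inordK // ltnS. Qed.

Lemma boxmK B : cancel (@boxm B) (tobox B).
Proof.
move=> k; apply/ffunP=> i; apply/val_inj; rewrite !ffunE /= inordK //.
Qed.

End Monomials.

Section Convolution.
(* The sum over k1 + k2 = m may be taken over any box containing m (convE). *)
Variables (N : nat) (R : pzRingType).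
Implicit Types (m : mono N) (f g h : mono N -> R).

Definition conv_box B f g m : R :=
  \sum_(k1 : box N B) \sum_(k2 : box N B | boxm k1 + boxm k2 == m)
     f (boxm k1) * g (boxm k2).

Definition conv f g m : R := conv_box (mdeg m) f g m.

Lemma conv_boxE B f g m : (forall i, m i <= B)%N ->
  conv_box B f g m =
  \sum_(k : {dffun forall i : 'I_N, 'I_(m i).+1})
    f [ffun i => k i : nat] * g [ffun i => (m i - k i)%N].
Proof.
move=> mB; rewrite /conv_box pair_big_dep /=.
have kB (k : {dffun forall i : 'I_N, 'I_(m i).+1}) i : (k i <= B)%N.
  by rewrite (leq_trans _ (mB i)) // -ltnS ltn_ord.
have dB (k : {dffun forall i : 'I_N, 'I_(m i).+1}) i : (m i - k i <= B)%N.
  by rewrite (leq_trans (leq_subr _ _)) // mB.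
pose F (k : {dffun forall i : 'I_N, 'I_(m i).+1}) : box N B * box N B :=
  (tobox B [ffun i => k i : nat], tobox B [ffun i => (m i - k i)%N]).
pose G (p : box N B * box N B) : {dffun forall i : 'I_N, 'I_(m i).+1} :=
  [ffun i => inord (p.1 i)].
rewrite (reindex_onto F G) /=; last first.
  move=> [k1 k2] /= /eqP /ffunP e; rewrite /F /G /=; congr pair;
  apply/ffunP => i; apply/val_inj; have := e i; rewrite !ffunE /= => ei.
    by rewrite !inordK // ltnS -ei leq_addr.
  by rewrite [(inord (k1 i) : 'I__) : nat]inordK ?ltnS -?ei ?leq_addr // addKn inordK.
apply: eq_big => [k|k _].
  rewrite /F /=; rewrite !toboxK; last 2 first.
  - by move=> i; rewrite ffunE.
  - by move=> i; rewrite ffunE.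
  apply/andP; split.
    apply/eqP/ffunP => i; rewrite monoDE !ffunE subnKC // -ltnS ltn_ord //.
  apply/eqP/ffunP => i; apply/val_inj; rewrite !ffunE /= inordK //.
    by rewrite inordK // ltnS.
  by rewrite inordK ?ltn_ord // ltnS.
by rewrite !toboxK // => i; rewrite ffunE.
Qed.

Lemma convE B f g m : (forall i, m i <= B)%N -> conv f g m = conv_box B f g m.
Proof. by move=> mB; rewrite /conv !conv_boxE // => i; exact: le_mdeg. Qed.

Lemma convA f g h : conv f (conv g h) = conv (conv f g) h.
Proof.
apply/funext => m.
rewrite -[LHS]/(conv_box (mdeg m) f (conv g h) m).
rewrite -[RHS]/(conv_box (mdeg m) (conv f g) h m).
set B := mdeg m.
have leB (k : box N B) i : (boxm k i <= B)%N by rewrite ffunE -ltnS ltn_ord.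
rewrite /conv_box.
transitivity (\sum_(k1 : box N B) \sum_(k2 : box N B) \sum_(k3 : box N B |
    boxm k1 + boxm k2 + boxm k3 == m)
    f (boxm k1) * g (boxm k2) * h (boxm k3)).
  apply: eq_bigr => k1 _.
  transitivity (\sum_(p : box N B | boxm k1 + boxm p == m)
    \sum_(k2 : box N B) \sum_(k3 : box N B | boxm k2 + boxm k3 == boxm p)
      f (boxm k1) * g (boxm k2) * h (boxm k3)).
    apply: eq_bigr => p _; rewrite (@convE B) // /conv_box mulr_sumr.
    apply: eq_bigr => k2 _; rewrite mulr_sumr; apply: eq_bigr => k3 _.
    by rewrite mulrA.
  rewrite exchange_big /=; apply: eq_bigr => k2 _.
  rewrite (exchange_big_dep xpredT) //= [RHS]big_mkcond /=.
  apply: eq_bigr => k3 _.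
  have [e|ne] := eqVneq.
    rewrite (big_pred1 (tobox B (boxm k2 + boxm k3))) //= => p.
    have le i : ((boxm k2 + boxm k3)%R i <= B)%N.
      rewrite (leq_trans _ (le_mdeg m i)) // -e !monoDE -addnA leq_addl //.
    apply/andP/eqP => [[_ /eqP ->]|->]; first by rewrite boxmK.
    by rewrite toboxK // addrA e.
  rewrite big_pred0 // => p; apply/andP => -[/eqP e1 /eqP e2].
  by case/eqP: ne; rewrite -e1 -e2 addrA.
symmetry.
transitivity (\sum_(p : box N B) \sum_(k3 : box N B | boxm p + boxm k3 == m)
  \sum_(k1 : box N B) \sum_(k2 : box N B | boxm k1 + boxm k2 == boxm p)
      f (boxm k1) * g (boxm k2) * h (boxm k3)).
  apply: eq_bigr => p _; apply: eq_bigr => k3 _.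
  rewrite (@convE B) // /conv_box mulr_suml.
  by apply: eq_bigr => k1 _; rewrite mulr_suml.
under eq_bigr do rewrite exchange_big /=.
rewrite exchange_big /=; apply: eq_bigr => k1 _.
transitivity (\sum_(p : box N B) \sum_(k2 : box N B) \sum_(k3 : box N B |
   (boxm p + boxm k3 == m) && (boxm k1 + boxm k2 == boxm p))
      f (boxm k1) * g (boxm k2) * h (boxm k3)).
  apply: eq_bigr => p _; rewrite (exchange_big_dep xpredT) //=.
rewrite exchange_big /=; apply: eq_bigr => k2 _.
rewrite (exchange_big_dep xpredT) //= [RHS]big_mkcond /=.
apply: eq_bigr => k3 _.
have [e|ne] := eqVneq (boxm k1 + boxm k2 + boxm k3) m.
  rewrite (big_pred1 (tobox B (boxm k1 + boxm k2))) //= => p.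
  have le i : ((boxm k1 + boxm k2)%R i <= B)%N.
    by rewrite (leq_trans _ (le_mdeg m i)) // -e [X in (_ <= X)%N]monoDE leq_addr.
  apply/andP/eqP => [[_ /eqP ->]|->]; first by rewrite boxmK.
  by rewrite toboxK // e.
rewrite big_pred0 // => p; apply/andP => -[/eqP e1 /eqP e2].
by case/eqP: ne; rewrite -e1 -e2.
Qed.

End Convolution.

Section Ring.
Variables (N : nat) (R : comNzRingType).
Implicit Types f g h : fps N R.

Definition fps_zero : fps N R := FPS (fun=> 0).
Definition fps_opp f : fps N R := FPS (fun m => - coef f m).
Definition fps_add f g : fps N R := FPS (fun m => coef f m + coef g m).

Fact fps_addA : associative fps_add.
Proof. by move=> f g h; apply/fpsP => m /=; rewrite addrA. Qed.
Fact fps_addC : commutative fps_add.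
Proof. by move=> f g; apply/fpsP => m /=; rewrite addrC. Qed.
Fact fps_add0 : left_id fps_zero fps_add.
Proof. by move=> f; apply/fpsP => m /=; rewrite add0r. Qed.
Fact fps_addN : left_inverse fps_zero fps_opp fps_add.
Proof. by move=> f; apply/fpsP => m /=; rewrite addNr. Qed.

HB.instance Definition _ :=
  GRing.isZmodule.Build (fps N R) fps_addA fps_addC fps_add0 fps_addN.

Definition fps_const (c : R) : fps N R := FPS (fun m => if m == 0 then c else 0).

(* (f * g)_m is the sum of f_k * g_l over the monomials k, l with k + l = m. *)
Definition fps_mul f g : fps N R := FPS (conv (coef f) (coef g)).

Fact fps_mulA : associative fps_mul.
Proof. by move=> f g h; congr FPS; rewrite /= convA. Qed.

Fact fps_mulC : commutative fps_mul.
Proof.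
move=> f g; apply/fpsP => m /=; rewrite /conv /conv_box.
rewrite (exchange_big_dep xpredT) //=; apply: eq_bigr => k _.
by apply: eq_big => [l|l _]; rewrite 1?addrC 1?mulrC.
Qed.

Fact fps_mul1 : left_id (fps_const 1) fps_mul.
Proof.
move=> f; apply/fpsP => m /=; rewrite /conv /conv_box.
have toB0 : boxm (tobox (mdeg m) 0) = 0 :> mono N.
  by rewrite toboxK // => i; rewrite ffunE.
have toBm : boxm (tobox (mdeg m) m) = m by rewrite toboxK //; exact: le_mdeg.
rewrite (bigD1 (tobox (mdeg m) 0)) //= toB0 eqxx.
rewrite [X in _ + X]big1 ?addr0 => [|k kn0]; last first.
  rewrite big1 // => l _; case: eqP => [k0|]; rewrite ?mul0r //.
  by case/eqP: kn0; rewrite -k0 boxmK.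
rewrite (big_pred1 (tobox (mdeg m) m)) ?toBm ?mul1r // => l.
by rewrite add0r /=; apply/eqP/eqP => [lm|->] //; rewrite -(boxmK l) lm.
Qed.

Fact fps_mulDl : left_distributive fps_mul fps_add.
Proof.
move=> f g h; apply/fpsP => m /=; rewrite /conv /conv_box -big_split /=.
by apply: eq_bigr => k _; rewrite -big_split /=; apply: eq_bigr => l _; rewrite mulrDl.
Qed.

Fact fps_1neq0 : fps_const 1 != 0.
Proof. by apply/eqP => /fpsP /(_ 0) /= /eqP; rewrite eqxx oner_eq0. Qed.

HB.instance Definition _ := GRing.Zmodule_isComNzRing.Build (fps N R)
  fps_mulA fps_mulC fps_mul1 fps_mulDl fps_1neq0.

Definition fps_var (i : 'I_N) : fps N R :=
  FPS (fun m => (m == [ffun j => (j == i) : nat])%:R).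

End Ring.

Section MatrixSeries.
Variables (N : nat) (C : numFieldType).

(* Matrix-valued formal power series in z, independent of t. *)
Definition zmx := nat -> 'M[C]_N.

Definition zmx_mul (f g : zmx) : zmx :=
  fun n => \sum_(i < n.+1) f i *m g (n - i)%N.

Definition zmx_one : zmx := fun n => if n == 0%N then 1%:M else 0.

Definition zmx_pow (f : zmx) (k : nat) : zmx := iter k (zmx_mul f) zmx_one.

(* exp(f(z)), for f(0) = 0: the terms f^k / k! with k > n do not contribute to
   the coefficient of z^n. *)
Definition zmx_exp (f : zmx) : zmx :=
  fun n => \sum_(k < n.+1) (k`!%:R)^-1 *: zmx_pow f k n.

Definition zmx_monom (l : nat) (r : 'M[C]_N) : zmx :=
  fun n => if n == l then r else 0.

(* Matrices of formal power series in t. *)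
Definition tmx := 'M[fps N C]_N.

Definition tmx_const (X : 'M[C]_N) : tmx := map_mx (@fps_const N C) X.

(* coefficient of t^m *)
Definition tmx_coef (m : mono N) (X : tmx) : 'M[C]_N :=
  map_mx (fun f => coef f m) X.

Definition diag_t : tmx := diag_mx (\row_i fps_var C i).

(* coefficient of z^q in exp (z diag(t^1, ..., t^N)) *)
Definition exp_zt (q : nat) : tmx :=
  tmx_const ((q`!%:R)^-1)%:M *m iter q (mulmx diag_t) 1%:M.

(* Coefficient of z^n t^m, n : int, in P(t,z) exp(z diag(t)) A(z^{-1}), where
   P(t,z) = sum_k P_k z^{-k}: the sum of the coefficients of t^m in
   P_k (diag(t)^q / q!) A_l over all q, k, l with q - k - l = n.  Since
   diag(t)^q has t-order q, only q <= |m| contribute, and then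
   k + l = q - n <= |m| + |n|. *)
Definition birkhoff_coef (P : nat -> tmx) (A : zmx) (n : int) (m : mono N) :
    'M[C]_N :=
  let B := (mdeg m + `|n|).+1 in
  \sum_(q < B) \sum_(k < B) \sum_(l < B | (q : nat)%:Z - k%:Z - l%:Z == n)
    tmx_coef m (P k *m exp_zt q *m tmx_const (A l)).

Definition birkhoff (A : zmx) (P Psi : nat -> tmx) : Prop :=
  P 0%N = 1%:M /\
  forall (n : int) (m : mono N),
    birkhoff_coef P A n m = if n is Posz k then tmx_coef m (Psi k) else 0.

(* Psi^+_k(A), for Psi^+(t,z) = sum_k Psi^+_k z^k; the factorization exists and
   is unique when A(0) is invertible, and the default 0 is then irrelevant. *)
Definition Psi_plus (A : zmx) : nat -> tmx :=
  xget (fun=> 0) [set Psi | exists P, birkhoff A P Psi]%classic.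

(* Psi^-(t,-z) Psi^+(t,z) = id *)
Definition psi_minus_of (Psip Psim : nat -> tmx) : Prop :=
  forall n, \sum_(i < n.+1) (-1) ^+ i *: (Psim i *m Psip (n - i)%N) =
            if n == 0%N then 1%:M else 0.

Definition Psi_minus (A : zmx) : nat -> tmx :=
  xget (fun=> 0) [set Psim | psi_minus_of (Psi_plus A) Psim]%classic.

Definition tower (A : zmx) (a b : nat) : tmx :=
  \sum_(i < b.+1) (-1) ^+ (b - i) *:
    (Psi_minus A (a + b + 1 - i)%N *m Psi_plus A i).

(* The (i,j) entry of the coefficient of t^m in M_{a,b}(A(z) exp(e r(z))), as a
   function of e. *)
Definition tower_orbit (A r : zmx) (a b : nat) (m : mono N) (i j : 'I_N) :
    C -> C :=
  fun e => coef (tower (zmx_mul A (zmx_exp (fun n => e *: r n))) a b i j) m.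

(* r(z).M_{a,b}(A), the (complex) derivative at e = 0 being taken
   coefficientwise *)
Definition tower_action (A r : zmx) (a b : nat) : tmx :=
  \matrix_(i, j) FPS (fun m => derive1 (tower_orbit A r a b m i j) 0).

(* The component of the g_+-action given by r_l z^l, on an arbitrary family M. *)
Definition gplus_action (M : nat -> nat -> tmx) (l : nat) (r : 'M[C]_N)
    (a b : nat) : tmx :=
  tmx_const r *m M (a + l)%N b
  - (-1) ^+ l *: (M a (b + l)%N *m tmx_const r)
  + \sum_(i < l) (-1) ^+ i.+1 *: (M a i *m tmx_const r *m M (l - 1 - i)%N b).

End MatrixSeries.

(* Main.v *)
Require Import Defs.
From mathcomp Require Import all_boot all_order all_algebra.
From mathcomp Require Import complex.
From mathcomp Require Import zify.
From mathcomp Require Import all_classical all_reals all_analysis.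
Set Implicit Arguments.
Unset Strict Implicit.
Unset Printing Implicit Defensive.
Import Order.TTheory GRing.Theory Num.Theory.
Import numFieldNormedType.Exports.
Local Open Scope ring_scope.

(** Work with series in [z] and [t] in which the power of [z] is at most the degree
    in [t]; with [w = 1/z] and [s = t z] these are ordinary power series, and the
    factorization reads [P E A = Psi], where [E = exp (diag s)] and [A] is a series
    in [w].  Write [X_-] and [X_+] for the parts of [X] with negative and nonnegative
    powers of [z].

    Existence and uniqueness of the factorization.  Conjugated by [A], the
    exponential becomes [D = A^-1 E A = 1 + O(t)], and [P A = A_0 + Y] solves the
    problem exactly when [Y = - ((A_0 + Y) (D - 1))_-].  The right-hand side raises
    the degree in [t], hence is a contraction with a unique fixed point
    ([birkhoff_exists], [birkhoff_unique]).  The argument works over any commutative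
    ring of coefficients.  Over the polynomials in [eps], applied to the series
    [A exp (eps r z^l)], it shows that every coefficient of the tower is a polynomial
    function along the orbit, so that the complex derivative exists and is the
    coefficient of [eps] ([orbit_factorization], [derive1_horner0]).

    Variation of the wave functions.  Let [Phi] be the inverse of [Psi], so that
    [Psi^-(z)] is [Phi(-z)].  To first order in [eps],
    [dPsi = dP E A + Psi r z^-l], hence [dPsi Phi - Psi r z^-l Phi = dP P^-1] is
    negative in [z], while [dPsi Phi] is nonnegative.  Therefore
    [dPsi = (z^-l Psi r Phi)_+ Psi] and [dPhi = - Phi (z^-l Psi r Phi)_+]
    ([wave_variation]).

    Variation of the tower.  Up to the sign [(-1)^(a + 1)] the tower is
    [K_(a, b) = sum_(i <= b) Phi_(a + b + 1 - i) Psi_i], which satisfies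
    [K_(a - 1, b) - K_(a, b - 1) = Phi_a Psi_b].  With this relation the products
    of coefficients of [Phi], [r] and [Psi] in [dK_(a, b)] become differences of
    terms [K r K], and the sum over [i] telescopes ([tower_variation]) to
    [dK_(a, b) = - r K_(a + l, b) + K_(a, b + l) r
                 + sum_(i + j = l - 1) K_(a, i) r K_(j, b)].
    Restoring the signs gives the [g_+]-action multiplied by [(-1)^(l + 1)]. *)

(** * Products of power series *)

Section Splittings.
Variable N : nat.
Implicit Types m : mono N.

Definition splitting m := {dffun forall i : 'I_N, 'I_(m i).+1}.
Definition lo m (k : splitting m) : mono N := [ffun i => k i : nat].
Definition hi m (k : splitting m) : mono N := [ffun i => (m i - k i)%N].

Lemma lo_hi m (k : splitting m) : lo k + hi k = m.
Proof.
by apply/ffunP => i; rewrite monoDE !ffunE subnKC // -ltnS ltn_ord.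
Qed.

Lemma mdegD m1 m2 : mdeg (m1 + m2) = (mdeg m1 + mdeg m2)%N.
Proof. by rewrite /mdeg -big_split /=; apply: eq_bigr => i _; rewrite monoDE. Qed.

Lemma mdeg_split m (k : splitting m) : (mdeg (lo k) + mdeg (hi k))%N = mdeg m.
Proof. by rewrite -mdegD lo_hi. Qed.

Lemma mdeg_eq0 m : (mdeg m == 0%N) = (m == 0).
Proof.
rewrite /mdeg sum_nat_eq0; apply/forallP/eqP => [m0|-> i]; last by rewrite ffunE.
by apply/ffunP => i; rewrite ffunE; apply/eqP; have := m0 i.
Qed.

(** The only splitting of [m] with trivial second part is [(m, 0)], so a factor
    free of [t] collapses a sum over splittings. *)
Lemma sum_splitting_hi0 (V : nmodType) m (F : mono N -> V) :
  \sum_(k : splitting m) (if hi k == 0 then F (lo k) else 0) = F m.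
Proof.
pose k0 : splitting m := [ffun i => ord_max].
have e0 : lo k0 = m by apply/ffunP => i; rewrite !ffunE.
have h0 : hi k0 = 0 by apply/ffunP => i; rewrite !ffunE subnn.
rewrite (bigD1 k0) //= h0 eqxx e0 big1 ?addr0 // => k kk0.
case: eqP => // hk; case/eqP: kk0; apply/ffunP => i; apply/val_inj.
move/ffunP: (lo_hi k) => /(_ i); rewrite hk addr0 !ffunE /= => ->.
by [].
Qed.

Lemma sum_splitting_lo0 (V : nmodType) m (F : mono N -> V) :
  \sum_(k : splitting m) (if lo k == 0 then F (hi k) else 0) = F m.
Proof.
pose k0 : splitting m := [ffun i => ord0].
have l0 : lo k0 = 0 by apply/ffunP => i; rewrite !ffunE.
have h0 : hi k0 = m by apply/ffunP => i; rewrite !ffunE subn0.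
rewrite (bigD1 k0) //= l0 eqxx h0 big1 ?addr0 // => k kk0.
case: eqP => // lk; case/eqP: kk0; apply/ffunP => i; apply/val_inj.
by move/ffunP: lk => /(_ i); rewrite !ffunE /= => ->.
Qed.

Lemma coef_mul (R : comNzRingType) (f g : fps N R) m :
  coef (f * g) m = \sum_(k : splitting m) coef f (lo k) * coef g (hi k).
Proof. by apply: conv_boxE => i; apply: le_mdeg. Qed.

Lemma coef_sum (R : comNzRingType) I (s : seq I) (P : pred I) (F : I -> fps N R) m :
  coef (\sum_(i <- s | P i) F i) m = \sum_(i <- s | P i) coef (F i) m.
Proof. by elim/big_rec2: _ => // i x y _ <-. Qed.

End Splittings.

(** The exponent of [w^j], for the one-variable series in [w]. *)
Definition uni (j : nat) : mono 1 := [ffun=> j].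

Lemma uniE (m : mono 1) : m = uni (m ord0).
Proof. by apply/ffunP => i; rewrite ffunE (ord1 i). Qed.

Lemma uni_eq0 j : (uni j == 0) = (j == 0%N).
Proof.
apply/eqP/eqP => [/(congr1 (fun m : mono 1 => m ord0))|->]; first by rewrite !ffunE.
by apply/ffunP => i; rewrite !ffunE.
Qed.

Lemma coef_mul_uni (R : comNzRingType) (f g : fps 1 R) j :
  coef (f * g) (uni j) = \sum_(i < j.+1) coef f (uni i) * coef g (uni (j - i)).
Proof.
rewrite coef_mul.
have uj i : uni j i = j by rewrite ffunE.
pose F (i : 'I_j.+1) : splitting (uni j) :=
  [ffun x => cast_ord (esym (congr1 S (uj x))) i].
rewrite (reindex_onto F (fun k => cast_ord (congr1 S (uj ord0)) (k ord0))) /=; last first.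
  move=> k _; apply/ffunP => x; apply/val_inj; have x0 : x = ord0 by rewrite ord1.
  by subst x; rewrite [F _ _]ffunE.
apply: eq_big => [i|i _].
  by apply/eqP/val_inj; rewrite [F _ _]ffunE.
have eF x : F i x = i :> nat by rewrite [F _ _]ffunE.
by congr (coef f _ * coef g _); apply/ffunP => x; rewrite [LHS]ffunE [RHS]ffunE eF ?uj.
Qed.

(** * Matrix series in w = 1/z and s = t z *)

(** The monomial [w^j s^m] stands for [z^(|m| - j) t^m].  In these coordinates
    the product of the factors [P(t,z)], [exp (z diag(t))] and [A(1/z)], whose
    expansion in [z] is infinite in the negative direction, is a product of
    ordinary power series.  The ring of these series is presented by its
    coefficients and kept abstract, so that no computation ever unfolds it. *)
Record bseries (N n : nat) (R : comNzRingType) := BSeries {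
  bser_ring :> pzRingType;
  bcoef : bser_ring -> mono N -> nat -> 'M[R]_n;
  bser_of : (mono N -> nat -> 'M[R]_n) -> bser_ring;
  bser_ofK : forall F m j, bcoef (bser_of F) m j = F m j;
  bcoefP : forall X Y, (forall m j, bcoef X m j = bcoef Y m j) -> X = Y;
  bcoefD : forall X Y m j, bcoef (X + Y) m j = bcoef X m j + bcoef Y m j;
  bcoef1 : forall m j, bcoef 1 m j = if (m == 0) && (j == 0%N) then 1%:M else 0;
  bcoefM : forall X Y m j, bcoef (X * Y) m j =
    \sum_(k : splitting m) \sum_(i < j.+1) bcoef X (lo k) i *m bcoef Y (hi k) (j - i);
  bser_mul1C : forall X Y : bser_ring, X * Y = 1 -> Y * X = 1 }.

(** The model is the ring of matrices over power series in [s] over power series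
    in [w]; one-sided inverses are two-sided there because scalars commute. *)
Lemma bser_model N n (R : comNzRingType) : bseries N n R.
Proof.
pose U := 'M[fps N (fps 1 R)]_n.
pose c (X : U) m j : 'M[R]_n := map_mx (fun f => coef (coef f m) (uni j)) X.
pose mk' (F : mono N -> nat -> 'M[R]_n) : U :=
  \matrix_(a, b) FPS (fun m => FPS (fun k : mono 1 => F m (k ord0) a b)).
apply: (@BSeries N n R U c mk').
- by move=> F m j; apply/matrixP => a b; rewrite !mxE /= ffunE.
- move=> X Y XY; apply/matrixP => a b; apply/fpsP => m; apply/fpsP => k.
  by have /matrixP/(_ a b) := XY m (k ord0); rewrite !mxE -uniE.
- by move=> X Y m j; apply/matrixP => a b; rewrite !mxE.
- move=> m j; apply/matrixP => a b.
  rewrite (fun_if (fun M : 'M[R]_n => M a b)) !mxE.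
  case: (a == b) => /=; last by rewrite !if_same.
  by case: (m == 0); rewrite //= uni_eq0; case: (j == 0%N).
- move=> X Y m j; apply/matrixP => a b; rewrite !mxE coef_sum coef_sum.
  under eq_bigr => d _.
    rewrite coef_mul coef_sum; under eq_bigr do rewrite coef_mul_uni; over.
  rewrite exchange_big summxE; apply: eq_bigr => k _ /=.
  rewrite exchange_big summxE; apply: eq_bigr => i _ /=.
  by rewrite mxE; apply: eq_bigr => d _; rewrite !mxE.
- by move=> X Y; apply: mulmx1C.
Qed.

Section Bser.
Variables (N n : nat) (R : comNzRingType) (U : bseries N n R).
Implicit Types (X Y Z : U) (m : mono N) (j d : nat) (S : mono N -> nat -> bool).

Lemma bcoef0 m j : bcoef (0 : U) m j = 0.
Proof. by apply: (addrI (bcoef (0 : U) m j)); rewrite -bcoefD !addr0. Qed.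

Lemma bcoefN X m j : bcoef (- X) m j = - bcoef X m j.
Proof. by apply: (addrI (bcoef X m j)); rewrite -bcoefD !subrr bcoef0. Qed.

Lemma bcoefB X Y m j : bcoef (X - Y) m j = bcoef X m j - bcoef Y m j.
Proof. by rewrite bcoefD bcoefN. Qed.

(** ** Supports *)

(** Support conditions stand for the closed subgroups of series used below:
    powers of [z] of a given sign, and the filtrations for which maps contract. *)
Definition supp S X :=
  forall m j, ~~ S m j -> bcoef X m j = 0.

Lemma suppW S S' X : (forall m j, S m j -> S' m j) -> supp S X -> supp S' X.
Proof. by move=> SS' SX m j nS; apply: SX; apply: contra nS; apply: SS'. Qed.

Lemma supp0 S : supp S (0 : U). Proof. by move=> m j _; rewrite bcoef0. Qed.

Lemma suppD S X Y : supp S X -> supp S Y -> supp S (X + Y).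
Proof. by move=> SX SY m j nS; rewrite bcoefD SX ?SY ?addr0. Qed.

Lemma suppN S X : supp S X -> supp S (- X).
Proof. by move=> SX m j nS; rewrite bcoefN SX ?oppr0. Qed.

Lemma suppB S X Y : supp S X -> supp S Y -> supp S (X - Y).
Proof. by move=> SX SY; apply: suppD => //; apply: suppN. Qed.

Lemma suppM S1 S2 S X Y :
  (forall m1 j1 m2 j2, S1 m1 j1 -> S2 m2 j2 -> S (m1 + m2) (j1 + j2)%N) ->
  supp S1 X -> supp S2 Y -> supp S (X * Y).
Proof.
move=> SS SX SY m j nS; rewrite bcoefM big1 // => k _; rewrite big1 // => i _.
have [Sx|nSx] := boolP (S1 (lo k) i); last by rewrite SX ?mul0mx.
rewrite [bcoef Y _ _]SY ?mulmx0 //; apply: contra nS => Sy.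
by have := SS _ _ _ _ Sx Sy; rewrite lo_hi subnKC // -ltnS.
Qed.

Definition cut S X : U :=
  bser_of U (fun m j => if S m j then bcoef X m j else 0).

Lemma supp_cut S X : supp S (cut S X).
Proof. by move=> m j /negbTE nS; rewrite bser_ofK nS. Qed.

Lemma supp_cutC S X : supp (fun m j => ~~ S m j) (X - cut S X).
Proof. by move=> m j /negPn Sm; rewrite bcoefB bser_ofK Sm subrr. Qed.

Lemma cutB S X Y : cut S (X - Y) = cut S X - cut S Y.
Proof. by apply: bcoefP => m j; rewrite !(bser_ofK, bcoefB); case: ifP; rewrite ?subrr. Qed.

Lemma cut_id S X : supp S X -> cut S X = X.
Proof. by move=> SX; apply: bcoefP => m j; rewrite bser_ofK; case: ifPn => // /SX. Qed.

Lemma cut_eq0 S S' X : (forall m j, ~~ (S m j && S' m j)) -> supp S' X -> cut S X = 0.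
Proof.
move=> SS SX; apply: bcoefP => m j; rewrite bser_ofK bcoef0; case: ifP => // Sm.
by apply: SX; have := SS m j; rewrite Sm.
Qed.

Lemma supp_cut2 S S' X : supp S' X -> supp S' (cut S X).
Proof. by move=> SX m j nS; rewrite bser_ofK SX ?if_same. Qed.

(** ** Contractions *)

Section Contraction.
Variable deg : mono N -> nat -> nat.
Variable Theta : U -> U.

(** For the distance [2^-d], with [d] the least degree in which two series
    differ. *)
Definition contraction := forall d X X',
  supp (fun m j => d <= deg m j)%N (X - X') ->
  supp (fun m j => d < deg m j)%N (Theta X - Theta X').

Hypothesis ThetaP : contraction.

Lemma supp_all_eq0 X : (forall d, supp (fun m j => d <= deg m j)%N X) -> X = 0.
Proof.
by move=> SX; apply: bcoefP => m j; rewrite bcoef0 (SX (deg m j).+1) // ltnn.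
Qed.

Lemma contraction_unique X X' : Theta X = X -> Theta X' = X' -> X = X'.
Proof.
move=> fX fX'; apply/eqP; rewrite -subr_eq0; apply/eqP/supp_all_eq0.
by elim=> [|d IH]; [move=> m j | rewrite -fX -fX'; apply: ThetaP].
Qed.

(** The iterates of [0] stabilize in each degree.  The invariant [S] records that
    the limit keeps any support condition respected by [Theta]. *)
Lemma contraction_fixpoint :
  exists Y, Theta Y = Y /\
    forall S, (forall X, supp S X -> supp S (Theta X)) -> supp S Y.
Proof.
pose It k := iter k Theta 0.
have step k : supp (fun m j => k <= deg m j)%N (It k.+1 - It k).
  by elim: k => [|k IH]; [move=> m j | apply: ThetaP].
have stepn k l : supp (fun m j => k <= deg m j)%N (It (k + l)%N - It k).
  elim: l => [|l IH]; first by rewrite addn0 subrr; apply: supp0.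
  rewrite addnS -[It _](subrK (It (k + l)%N)) -addrA; apply: suppD => //.
  by apply: suppW (step _) => m j; apply: leq_trans; rewrite leq_addr.
(* The coefficients of degree [d] no longer change after [d + 1] steps. *)
pose Y := bser_of U (fun m j => bcoef (It (deg m j).+1) m j).
have Yn k : supp (fun m j => k <= deg m j)%N (Y - It k).
  move=> m j; rewrite -ltnNge => lt; rewrite bcoefB bser_ofK -opprB -bcoefB.
  by rewrite -(subnKC lt) stepn ?oppr0 // -ltnNge.
exists Y; split.
  apply/eqP; rewrite -subr_eq0; apply/eqP/supp_all_eq0 => d.
  have -> : Theta Y - Y = (Theta Y - Theta (It d)) - (Y - It d.+1).
    by rewrite opprB addrA subrK.
  apply: suppB; first by apply: suppW (ThetaP (Yn d)) => m j; apply: ltnW.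
  by apply: suppW (Yn d.+1) => m j; apply: ltnW.
move=> S SP; have SI k : supp S (It k) by elim: k => [|k IH]; [apply: supp0|apply: SP].
by move=> m j nS; rewrite bser_ofK SI.
Qed.

End Contraction.

(** ** Series in w, free of s *)

Definition wser (a : nat -> 'M[R]_n) : U := bser_of U (fun m j => if m == 0 then a j else 0).

Lemma supp_wser a : supp (fun m _ => m == 0) (wser a).
Proof. by move=> m j /negbTE m0; rewrite bser_ofK m0. Qed.

Lemma bcoef_wserr X a m j : bcoef (X * wser a) m j = \sum_(i < j.+1) bcoef X m i *m a (j - i)%N.
Proof.
rewrite bcoefM -[RHS](sum_splitting_hi0 m (fun m => \sum_(i < j.+1) bcoef X m i *m a (j - i)%N)).
apply: eq_bigr => k _; case: ifPn => [/eqP hk|hk].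
  by apply: eq_bigr => i _; rewrite bser_ofK hk eqxx.
by rewrite big1 // => i _; rewrite bser_ofK (negbTE hk) mulmx0.
Qed.

Lemma bcoef_wserl X a m j : bcoef (wser a * X) m j = \sum_(i < j.+1) a i *m bcoef X m (j - i)%N.
Proof.
rewrite bcoefM -[RHS](sum_splitting_lo0 m (fun m => \sum_(i < j.+1) a i *m bcoef X m (j - i)%N)).
apply: eq_bigr => k _; case: ifPn => [/eqP hk|hk].
  by apply: eq_bigr => i _; rewrite bser_ofK hk eqxx.
by rewrite big1 // => i _; rewrite bser_ofK (negbTE hk) mul0mx.
Qed.

Lemma wserM a b : wser a * wser b = wser (fun j => \sum_(i < j.+1) a i *m b (j - i)%N).
Proof.
apply: bcoefP => m j; rewrite bcoef_wserr bser_ofK; case: ifP => [m0|m0].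
  by apply: eq_bigr => i _; rewrite bser_ofK m0.
by rewrite big1 // => i _; rewrite bser_ofK m0 mul0mx.
Qed.

Definition bconst (x : 'M[R]_n) : U := wser (fun j => if j == 0%N then x else 0).

Lemma bconstM x y : bconst x * bconst y = bconst (x *m y).
Proof.
rewrite wserM; congr wser; apply/funext => j; rewrite big_ord_recl /= subn0 big1.
  by case: (j); rewrite /= ?addr0 ?mulmx0.
by move=> i _; rewrite mul0mx.
Qed.

Lemma supp_bconst x : supp (fun m j => (m == 0) && (j == 0%N)) (bconst x).
Proof. by move=> m j; rewrite negb_and bser_ofK; case: eqP => //= _ /negbTE ->. Qed.

Lemma bconst1 : bconst 1%:M = 1.
Proof.
by apply: bcoefP => m j; rewrite bser_ofK bcoef1; case: (m == 0).
Qed.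

End Bser.

(** * Inverses and the Birkhoff factorization *)

Section Factorization.
Variables (N n : nat) (R : comNzRingType) (U : bseries N n R).
Implicit Types (X Y Z : U) (m : mono N) (j d : nat) (S : mono N -> nat -> bool).

(** As [w^j s^m] is [z^(|m| - j) t^m], these are the exponents with negative,
    nonnegative and nonpositive power of [z]. *)
Definition negz m j := (mdeg m < j)%N.
Definition posz m j := (j <= mdeg m)%N.
Definition nposz m j := (mdeg m <= j)%N.

Lemma mdeg0 : mdeg (0 : mono N) = 0%N.
Proof. by apply/eqP; rewrite mdeg_eq0. Qed.

Lemma supp_bconstW S x : S 0 0%N -> supp S (bconst U x).
Proof. by move=> S0; apply: suppW (supp_bconst U x) => m j /andP[/eqP-> /eqP->]. Qed.

Lemma supp_1 S : S 0 0%N -> supp S (1 : U).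
Proof. by rewrite -(bconst1 U); apply: supp_bconstW. Qed.

Lemma supp_wser_nposz a : supp nposz (wser U a).
Proof. by apply: suppW (supp_wser U a) => m j /eqP->; rewrite /nposz mdeg0. Qed.

Lemma supp_posM X Y : supp posz X -> supp posz Y -> supp posz (X * Y).
Proof. by apply: suppM => m1 j1 m2 j2 *; rewrite /posz mdegD leq_add. Qed.

Lemma supp_negM X Y : supp negz X -> supp nposz Y -> supp negz (X * Y).
Proof.
by apply: suppM => m1 j1 m2 j2 *; rewrite /negz mdegD -addSn leq_add.
Qed.

Lemma negz_posz m j : ~~ (negz m j && posz m j).
Proof. by rewrite /negz /posz ltnNge andNb. Qed.

Lemma supp_cut_negzC X : supp posz (X - cut negz X).
Proof. by apply: suppW (supp_cutC (S := negz) X) => m j; rewrite /negz -leqNgt. Qed.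

Lemma affine_contraction (deg : mono N -> nat -> nat) (Lam : U -> U) Y0 :
  (forall X Y, Lam (X - Y) = Lam X - Lam Y) ->
  (forall d X, supp (fun m j => d <= deg m j)%N X ->
               supp (fun m j => d < deg m j)%N (Lam X)) ->
  contraction deg (fun X => Y0 + Lam X).
Proof. by move=> LB Lc d X X' /Lc; rewrite LB opprD addrACA subrr add0r. Qed.

(** Writing [X] as [x0 + X'] with [x0] its constant term, the inverse solves
    [Y = x0^-1 - x0^-1 X' Y], a contraction for the total degree; it only
    involves exponents generated by those of [X]. *)
Lemma bser_inverse X x : bcoef X 0 0 *m x = 1%:M ->
  exists Y, X * Y = 1 /\
    forall S, S 0 0%N ->
      (forall m1 j1 m2 j2, S m1 j1 -> S m2 j2 -> S (m1 + m2) (j1 + j2)%N) ->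
      supp S X -> supp S Y.
Proof.
move=> Xx; pose X' := X - bconst U (bcoef X 0 0).
have X'_s : supp (fun m j => 0 < mdeg m + j)%N X'.
  move=> m j; rewrite -eqn0Ngt addn_eq0 mdeg_eq0 => /andP[/eqP-> /eqP->].
  by rewrite bcoefB bser_ofK !eqxx subrr.
pose Lam Y := - (bconst U x * X' * Y).
have [|Y [fY SY]] := @contraction_fixpoint N n R U (fun m j => mdeg m + j)%N
   (fun Y => bconst U x + Lam Y).
  apply: affine_contraction => [Y Z|d Y dY].
    by rewrite /Lam mulrBr opprB opprK addrC.
  have SXY : supp (fun m j => d < mdeg m + j)%N (X' * Y).
    apply: suppM X'_s dY => m1 j1 m2 j2 p1 p2.
    by rewrite mdegD addnACA -add1n leq_add.
  apply: suppN; rewrite -mulrA; apply: (suppM (S1 := fun _ _ => true)) SXY => //.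
  move=> m1 j1 m2 j2 _ /leq_trans; apply.
  by rewrite mdegD addnACA leq_addl.
exists Y; split.
  rewrite -[X](subrK (bconst U (bcoef X 0 0))) -/X' mulrDl -{2}fY mulrDr bconstM Xx bconst1.
  by rewrite /Lam mulrN -!mulrA [bconst _ _ * (bconst _ _ * _)]mulrA bconstM Xx bconst1 mul1r addrC subrK.
move=> S S0 SM SX; apply: SY => Z SZ; apply: suppD; first exact: supp_bconstW.
apply: suppN; apply: (suppM SM _ SZ); apply: (suppM SM _ _); first exact: supp_bconstW.
by apply: suppB => //; apply: supp_bconstW.
Qed.

Variables (a : nat -> 'M[R]_n) (a0' : 'M[R]_n) (E : U).
Hypothesis a0K : a 0%N *m a0' = 1%:M.
Hypothesis E1 : supp (fun m _ => 0 < mdeg m)%N (E - 1).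
Local Notation A := (wser U a).

Lemma wser_inverse : exists2 B : U, A * B = 1 & supp nposz B.
Proof.
have [|B [AB SB]] := @bser_inverse A a0'; first by rewrite bser_ofK eqxx.
exists B => //; apply: SB; first by rewrite /nposz mdeg0.
  by move=> m1 j1 m2 j2 *; rewrite /nposz mdegD leq_add.
exact: supp_wser_nposz.
Qed.

(** Conjugating [E = 1 + O(t)] by [A] makes it [1] at [t = 0], so that
    multiplication by [A^-1 E A - 1] raises the degree in [t]. *)
Lemma conj_contraction (B : U) : B * A = 1 ->
  supp (fun m _ => 0 < mdeg m)%N (B * E * A - 1).
Proof.
move=> BA; have -> : B * E * A - 1 = B * (E - 1) * A.
  by rewrite mulrBr mulr1 mulrBl BA.
apply: (suppM (S2 := fun _ _ => true) (S1 := fun m _ => 0 < mdeg m)%N) => //.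
  by move=> *; rewrite mdegD addn_gt0; apply/orP; left.
apply: (suppM (S1 := fun _ _ => true) (S2 := fun m _ => 0 < mdeg m)%N) => //.
by move=> *; rewrite mdegD addn_gt0; apply/orP; right.
Qed.

Lemma cut_negz_contraction (Y0 D : U) : supp (fun m _ => 0 < mdeg m)%N D ->
  contraction (fun m _ => mdeg m) (fun Y => Y0 - cut negz (Y * D)).
Proof.
move=> SD; apply: affine_contraction => [X Y|d X dX].
  by rewrite mulrBl cutB opprB opprK addrC.
apply: suppN; apply: supp_cut2; apply: suppM dX SD => m1 j1 m2 j2 p1 p2.
by rewrite mdegD -addn1 leq_add.
Qed.

(** With [Y = Q A] and [D = A^-1 E A = 1 + O(t)], negativity of [Y] and
    nonnegativity of [Y D] say that [Y] is the fixed point [0] of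
    [Y |-> - (Y (D - 1))_-]. *)
Lemma birkhoff_unique (Q : U) :
  supp negz Q -> supp posz (Q * E * A) -> Q = 0.
Proof.
move=> SQ SP; have [B AB _] := wser_inverse; have BA := bser_mul1C AB.
have SD := conj_contraction BA.
have [D DE] : exists D, D = B * E * A by exists (B * E * A).
rewrite -DE in SD.
have SY : supp negz (Q * A) by apply: supp_negM SQ (supp_wser_nposz a).
have YD : Q * A * D = Q * E * A.
  by rewrite DE !mulrA -[Q * A * B]mulrA AB mulr1.
suff Y0 : Q * A = 0 by rewrite -[Q]mulr1 -AB mulrA Y0 mul0r.
have CD := cut_negz_contraction 0 SD.
apply: (contraction_unique CD).
  rewrite sub0r mulrBr YD mulr1 cutB.
  rewrite (cut_id SY) (cut_eq0 negz_posz SP).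
  by rewrite sub0r opprK.
rewrite sub0r mul0r.
by rewrite (cut_eq0 negz_posz (@supp0 _ _ _ U _)) oppr0.
Qed.

(** Put [D = A^-1 E A] and look for [P A = A_0 + Y] with [Y] negative in [z].
    Then [P E A = (A_0 + Y) D], and its negative part vanishes exactly when
    [Y = - ((A_0 + Y) (D - 1))_-]. *)
Lemma birkhoff_exists : exists P Psi : U,
  [/\ supp negz (P - 1), supp posz Psi, P * E * A = Psi &
      bcoef Psi 0 0 = a 0%N].
Proof.
have [B AB SB] := wser_inverse; have BA := bser_mul1C AB.
have SD := conj_contraction BA.
have [D DE] : exists D, D = B * E * A by exists (B * E * A).
rewrite -DE in SD.
pose c := bconst U (a 0%N).
have [Y [fY _]] := contraction_fixpoint
  (cut_negz_contraction (- cut negz (c * (D - 1))) SD).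
pose W := (c + Y) * (D - 1).
have YW : Y = - cut negz W.
  by rewrite -{1}fY /W mulrDl -opprD; congr (- _); apply: bcoefP => m j;
     rewrite !(bser_ofK, bcoefD); case: ifP; rewrite ?addr0.
have SY : supp negz Y by rewrite YW; apply/suppN/supp_cut.
exists ((c + Y) * B), ((c + Y) * D); split.
- rewrite -AB -mulrBl addrAC; apply: supp_negM SB; apply: suppD SY.
  move=> m j; rewrite /negz -leqNgt bcoefB !bser_ofK; case: eqP => [->|_ _]; last by rewrite subrr.
  by rewrite mdeg0 leqn0 => /eqP->; rewrite eqxx subrr.
- have -> : (c + Y) * D = c + (W - cut negz W).
    by rewrite -YW addrA addrAC -[D](subrK 1) mulrDr mulr1 addrC.
  by apply: suppD (supp_cut_negzC _); apply: supp_bconstW.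
- by rewrite DE !mulrA.
- have -> : (c + Y) * D = c + (W - cut negz W).
    by rewrite -YW addrA addrAC -[D](subrK 1) mulrDr mulr1 addrC.
  have SW : supp (fun m _ => 0 < mdeg m)%N W.
    by apply: (suppM (S1 := fun _ _ => true)) SD => // *; rewrite mdegD addn_gt0; apply/orP; right.
  have -> : bcoef (c + (W - cut negz W)) 0 0 = a 0%N + (bcoef W 0 0 - 0).
    by rewrite bcoefD bcoefB !bser_ofK !eqxx /negz mdeg0.
  by rewrite SW ?mdeg0 // !subr0 addr0.
Qed.

End Factorization.

(** * Expansion in powers of z *)

Section NatSums.
Variable V : nmodType.

Lemma sum_ord_trunc a b (F : nat -> V) :
  (forall i, (b <= i < a)%N -> F i = 0) ->
  \sum_(i < a) F i = \sum_(i < b) (if (i < a)%N then F i else 0).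
Proof.
move=> F0; rewrite (big_ord_widen (a + b) F (leq_addr _ _)).
rewrite (big_ord_widen (a + b) (fun i => if (i < a)%N then F i else 0) (leq_addl _ _)).
rewrite big_mkcond [RHS]big_mkcond /=; apply: eq_bigr => i _.
by case: ltnP => [ia|]; case: ltnP => // bi; rewrite F0 ?ia ?bi.
Qed.

Lemma sum_antidiagonal B j p (F : nat -> nat -> V) : (j < B)%N ->
  \sum_(k < B) \sum_(l < B | (k + l + p == j)%N) F k l =
  \sum_(i < j.+1) (if (p <= i)%N then F (i - p)%N (j - i)%N else 0).
Proof.
move=> jB.
transitivity (\sum_(k < B) (if (k + p <= j)%N then F k (j - (k + p))%N else 0)).
  apply: eq_bigr => k _; case: leqP => [kj|jk].
    have lB : (j - (k + p) < B)%N by rewrite (leq_ltn_trans (leq_subr _ _)).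
    rewrite (big_pred1 (Ordinal lB)) // => l /=.
    rewrite -(inj_eq val_inj) /= addnAC.
    by apply/eqP/eqP => [<-|->]; [rewrite addKn | rewrite subnKC].
  rewrite big_pred0 // => l; apply/eqP => e.
  by move: jk; rewrite -e addnAC ltnNge leq_addr.
have [pj|jp] := leqP p j; last first.
  rewrite !big1 // => i _; first by rewrite leqNgt (leq_trans (ltn_ord i)).
  by rewrite leqNgt (leq_trans jp) ?leq_addl.
rewrite (sum_ord_trunc (b := (j - p).+1) (F := fun k =>
   if (k + p <= j)%N then F k (j - (k + p))%N else 0)); last first.
  by move=> i /andP[+ _]; rewrite ltn_subLR // ltnNge addnC => /negbTE ->.
rewrite -[in RHS](subnKC pj) -addnS big_split_ord /= [X in _ = X + _]big1 ?add0r; last first.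
  by move=> i _; rewrite leqNgt ltn_ord.
apply: eq_bigr => i _; have ijp : (i <= j - p)%N by rewrite -ltnS.
have -> : (i < B)%N by lia.
have -> : (i + p <= j)%N by lia.
by rewrite leq_addr addKn; congr F; lia.
Qed.

End NatSums.

(** Both sides are the sum of [x a * y b] over [a <= p], [b <= q] with
    [a + b + n = p + q]. *)
Lemma sum_complement (W : pzRingType) p q n (x y : nat -> W) :
  (forall i, (p < i)%N -> x i = 0) -> (forall i, (q < i)%N -> y i = 0) ->
  (if (n <= p + q)%N then \sum_(i < (p + q - n).+1) x i * y (p + q - n - i)%N else 0) =
  \sum_(i < n.+1) (if (i <= p)%N then x (p - i)%N else 0) *
     (if (n - i <= q)%N then y (q - (n - i))%N else 0).
Proof.
move=> x0 y0; case: leqP => [npq|pqn]; last first.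
  rewrite big1 // => i _; case: leqP => [ip|]; last by rewrite mul0r.
  case: leqP => [nq|]; last by rewrite mulr0.
  by lia.
rewrite (sum_ord_trunc (b := p.+1) (F := fun i => x i * y (p + q - n - i)%N)); last first.
  by move=> i /andP[pi _]; rewrite x0 ?mul0r.
rewrite (sum_ord_trunc (b := p.+1) (F := fun i =>
   (if (i <= p)%N then x (p - i)%N else 0) *
     (if (n - i <= q)%N then y (q - (n - i))%N else 0))); last first.
  by move=> i /andP[pi _]; rewrite leqNgt pi mul0r.
rewrite (reindex_inj rev_ord_inj) /=; apply: eq_bigr => i _.
have ip : (i <= p)%N by rewrite -ltnS.
rewrite subSS ip ltnS; case: ltnP => [ilt|ige]; last first.
  by case: leqP => // le1; rewrite y0 ?mulr0 //; lia.
have eq1 : (p - i <= p + q - n)%N = (n - i <= q)%N by lia.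
rewrite eq1; case: leqP => le2; last by rewrite mulr0.
by congr (_ * y _); lia.
Qed.

(** ** Coefficients of powers of z *)

Section TCoefficients.
Variables (N n : nat) (R : comNzRingType).
Local Notation T := 'M[fps N R]_n.
Implicit Types (X Y : T) (m : mono N).

Definition tcoef X m : 'M[R]_n := map_mx (fun f => coef f m) X.

Definition tser_of (F : mono N -> 'M[R]_n) : T := \matrix_(a, b) FPS (fun m => F m a b).

Lemma tser_ofK F m : tcoef (tser_of F) m = F m.
Proof. by apply/matrixP => a b; rewrite !mxE. Qed.

Lemma tcoefP X Y : (forall m, tcoef X m = tcoef Y m) -> X = Y.
Proof.
move=> XY; apply/matrixP => a b; apply/fpsP => m.
by have /matrixP/(_ a b) := XY m; rewrite !mxE.
Qed.

Lemma tcoefD X Y m : tcoef (X + Y) m = tcoef X m + tcoef Y m.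
Proof. by apply/matrixP => a b; rewrite !mxE. Qed.

Lemma tcoefN X m : tcoef (- X) m = - tcoef X m.
Proof. by apply/matrixP => a b; rewrite !mxE. Qed.

Lemma tcoef0 m : tcoef 0 m = 0.
Proof. by apply/matrixP => a b; rewrite !mxE. Qed.

Lemma tcoef_sum I (s : seq I) (P : pred I) (F : I -> T) m :
  tcoef (\sum_(i <- s | P i) F i) m = \sum_(i <- s | P i) tcoef (F i) m.
Proof.
by elim/big_rec2: _ => [|i x y _ <-]; rewrite ?tcoef0 ?tcoefD.
Qed.

Lemma tcoefM X Y m :
  tcoef (X *m Y) m = \sum_(k : splitting m) tcoef X (lo k) *m tcoef Y (hi k).
Proof.
apply/matrixP => a b; rewrite !mxE coef_sum.
under eq_bigr do rewrite coef_mul.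
rewrite exchange_big summxE; apply: eq_bigr => k _ /=.
by rewrite mxE; apply: eq_bigr => d _; rewrite !mxE.
Qed.

Lemma tcoef_const (x : 'M[R]_n) m :
  tcoef (map_mx (@fps_const N R) x) m = if m == 0 then x else 0.
Proof. by apply/matrixP => a b; rewrite !mxE /=; case: eqP; rewrite ?mxE. Qed.

Lemma const1 : map_mx (@fps_const N R) 1%:M = 1%:M :> T.
Proof.
by apply/matrixP => a b; rewrite !mxE; case: (a == b) => //=; apply/fpsP => m /=; case: eqP.
Qed.

Lemma tcoef1 m : tcoef 1%:M m = if m == 0 then 1%:M else 0.
Proof. by rewrite -const1 tcoef_const. Qed.

Lemma tcoefM_constr X (x : 'M[R]_n) m :
  tcoef (X *m map_mx (@fps_const N R) x) m = tcoef X m *m x.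
Proof.
rewrite tcoefM -[RHS](sum_splitting_hi0 m (fun m => tcoef X m *m x)).
by apply: eq_bigr => k _; rewrite tcoef_const; case: ifP; rewrite ?mulmx0.
Qed.

End TCoefficients.

Section ZCoefficients.
Variables (N n : nat) (R : comNzRingType) (U : bseries N n R).
Implicit Types (X Y : U) (m : mono N).

(** The coefficient of [z^k] is read off at the exponents with [|m| - j = k], for
    [k >= 0]; these determine a series without negative powers of [z]. *)
Definition zcoef X (k : nat) : 'M[fps N R]_n :=
  tser_of (fun m => if (k <= mdeg m)%N then bcoef X m (mdeg m - k) else 0).

Lemma tcoef_zcoef X k m :
  tcoef (zcoef X k) m = if (k <= mdeg m)%N then bcoef X m (mdeg m - k) else 0.
Proof. exact: tser_ofK. Qed.

Lemma zcoefN X k : zcoef (- X) k = - zcoef X k.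
Proof.
by apply/tcoefP => m; rewrite tcoefN !tcoef_zcoef bcoefN; case: ifP; rewrite ?oppr0.
Qed.

Lemma zcoef_const x k :
  zcoef (bconst U x) k = if k == 0%N then map_mx (@fps_const N R) x else 0.
Proof.
apply/tcoefP => m; rewrite tcoef_zcoef (fun_if (fun V => tcoef V m)) tcoef_const tcoef0 bser_ofK.
have [->|m0] := eqVneq m 0; first by rewrite mdeg0 leqn0; case: eqP => [->|//].
by rewrite !if_same.
Qed.

Lemma zcoef1 k : zcoef (1 : U) k = if k == 0%N then 1%:M else 0.
Proof. by rewrite -(bconst1 U) zcoef_const const1. Qed.

(** Without negative powers of [z] in the factors, the sum giving a coefficient of
    the product is finite. *)
Lemma zcoefM X Y k : supp (@posz N) X -> supp (@posz N) Y ->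
  zcoef (X * Y) k = \sum_(i < k.+1) zcoef X i *m zcoef Y (k - i)%N.
Proof.
move=> SX SY; apply/tcoefP => m; rewrite tcoef_zcoef tcoef_sum.
under [RHS]eq_bigr do rewrite tcoefM.
rewrite exchange_big /= bcoefM -[if _ then _ else _]/(if (k <= mdeg m)%N then _ else _).
transitivity (\sum_(s : splitting m)
   if (k <= mdeg m)%N then
     \sum_(i < (mdeg m - k).+1) bcoef X (lo s) i *m bcoef Y (hi s) (mdeg m - k - i)
   else 0).
  by case: ifP => // _; rewrite big1.
apply: eq_bigr => s _; rewrite -(mdeg_split s) !mulmxE.
rewrite (@sum_complement ('M[R]_n : pzRingType)) => [|i pi|i qi].
- by apply: eq_bigr => i _; rewrite !tcoef_zcoef.
- by apply: SX; rewrite /posz -ltnNge.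
- by apply: SY; rewrite /posz -ltnNge.
Qed.

Definition wpow l : U := wser U (fun j => if j == l then 1%:M else 0).

Lemma bcoef_wpow X l m j :
  bcoef (X * wpow l) m j = if (l <= j)%N then bcoef X m (j - l) else 0.
Proof.
rewrite bcoef_wserr; case: leqP => [lj|jl]; last first.
  by rewrite big1 // => i _; case: eqP => [?|]; rewrite ?mulmx0 //; lia.
have lt : (j - l < j.+1)%N by lia.
rewrite (bigD1 (Ordinal lt)) //= subKn // eqxx mulmx1 big1 ?addr0 // => i ne.
case: eqP => [e|]; rewrite ?mulmx0 //; case/eqP: ne; apply: val_inj => /=.
by have := ltn_ord i; lia.
Qed.

Lemma wpowC X l : wpow l * X = X * wpow l.
Proof.
apply: bcoefP => m j; rewrite bcoef_wpow bcoef_wserl; case: leqP => [lj|jl]; last first.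
  by rewrite big1 // => i _; case: eqP => [?|]; rewrite ?mul0mx //; have := ltn_ord i; lia.
have lt : (l < j.+1)%N by lia.
rewrite (bigD1 (Ordinal lt)) //= eqxx mul1mx big1 ?addr0 // => i ne.
by case: eqP => [e|]; rewrite ?mul0mx //; case/eqP: ne; apply: val_inj.
Qed.

(** [w^l] is [z^-l]. *)
Lemma zcoef_wpow X l k : zcoef (X * wpow l) k = zcoef X (k + l).
Proof.
apply/tcoefP => m; rewrite !tcoef_zcoef bcoef_wpow.
have -> : (k + l <= mdeg m)%N = (k <= mdeg m)%N && (l <= mdeg m - k)%N by lia.
by case: ifP => //= _; rewrite subnDA.
Qed.

Lemma zcoef_cut_posz X k : zcoef (cut (@posz N) X) k = zcoef X k.
Proof.
apply/tcoefP => m; rewrite !tcoef_zcoef bser_ofK; case: ifP => // _.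
by rewrite /posz leq_subr.
Qed.

End ZCoefficients.

(** * The wave functions *)

Section WaveFunctions.
Variables (N : nat) (C : numFieldType) (U : bseries N N C).
Local Notation T := (tmx N C).
Implicit Types (m : mono N) (A : zmx N C) (X : U).

Lemma exp_zt0 : exp_zt N C 0 = 1%:M.
Proof. by rewrite /exp_zt fact0 invr1 mulmx1; apply: const1. Qed.

Lemma exp_zt_homogeneous q m : mdeg m != q -> tmx_coef m (exp_zt N C q) = 0.
Proof.
have homM (X Y : T) p r : (forall m, mdeg m != p -> tcoef X m = 0) ->
    (forall m, mdeg m != r -> tcoef Y m = 0) ->
    forall m, mdeg m != (p + r)%N -> tcoef (X *m Y) m = 0.
  move=> hX hY m' ne; rewrite tcoefM big1 // => k _.
  have [e1|/hX->] := eqVneq (mdeg (lo k)) p; last by rewrite mul0mx.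
  have [e2|/hY->] := eqVneq (mdeg (hi k)) r; last by rewrite mulmx0.
  by case/eqP: ne; rewrite -(mdeg_split k) e1 e2.
have hc (x : 'M[C]_N) m' : mdeg m' != 0%N -> tcoef (map_mx (@fps_const N C) x) m' = 0.
  by rewrite tcoef_const mdeg_eq0 => /negbTE->.
have hd m' : mdeg m' != 1%N -> tcoef (diag_t N C) m' = 0.
  move=> ne; apply/matrixP => a b; rewrite !mxE; case: (a == b) => //=.
  case: eqP => // e; case/eqP: ne; rewrite e /mdeg.
  rewrite (bigD1 a) //= ffunE eqxx big1 // => i /negbTE ia.
  by rewrite ffunE ia.
rewrite /exp_zt; apply: (homM _ _ 0%N q) => // m'; first exact: hc.
elim: q m' => [|q IH] m' ne; first by rewrite /= tcoef1; rewrite mdeg_eq0 in ne; rewrite (negbTE ne).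
by apply: (homM _ _ 1%N q) ne.
Qed.

(** [exp (z diag(t)) = exp (diag(s))]. *)
Definition expz : U :=
  bser_of U (fun m j => if j == 0%N then tmx_coef m (exp_zt N C (mdeg m)) else 0).

Lemma supp_expz1 : supp (fun m _ => 0 < mdeg m)%N (expz - 1).
Proof.
move=> m j; rewrite -eqn0Ngt mdeg_eq0 => /eqP->.
rewrite bcoefB bser_ofK bcoef1 eqxx /= mdeg0 exp_zt0.
by case: eqP => _; rewrite ?subrr // [tmx_coef _ _]tcoef1 eqxx subrr.
Qed.

(** [P = sum_k P_k z^-k] as a series in [w] and [s]. *)
Definition negseries (P : nat -> T) : U :=
  bser_of U (fun m j => if (mdeg m <= j)%N then tcoef (P (j - mdeg m)%N) m else 0).

(** In the triple sum defining [birkhoff_coef], homogeneity of the exponential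
    forces [q] to be the degree of its monomial; the remaining condition on [k] and
    [l] is the one on the exponent of [w]. *)
Lemma birkhoff_coef_bser (P : nat -> T) A m n j : (mdeg m)%:Z - n = j%:Z ->
  birkhoff_coef P A n m = bcoef (negseries P * expz * wser U A) m j.
Proof.
move=> nj; rewrite /birkhoff_coef; set B := (mdeg m + _).+1.
have jB : (j < B)%N by rewrite /B; lia.
pose F (s : splitting m) k l :=
  tcoef (P k) (lo s) *m tmx_coef (hi s) (exp_zt N C (mdeg (hi s))) *m A l.
transitivity (\sum_(s : splitting m) \sum_(k < B)
  \sum_(l < B | (k + l + mdeg (lo s) == j)%N) F s k l).
  under eq_bigr => q _.
    under eq_bigr => k _.
      under eq_bigr => l _.
        rewrite [tmx_coef _ _]tcoefM_constr tcoefM mulmx_suml.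
        over.
      rewrite exchange_big /=.
      over.
    rewrite exchange_big /=.
    over.
  rewrite exchange_big /=; apply: eq_bigr => s _.
  have ms := mdeg_split s.
  have qB : (mdeg (hi s) < B)%N by rewrite /B; lia.
  rewrite (bigD1 (Ordinal qB)) //= [X in _ + X]big1 ?addr0; last first.
    move=> q ne; rewrite big1 // => k _; rewrite big1 // => l _.
    rewrite [tcoef (exp_zt _ _ _) _]exp_zt_homogeneous ?mulmx0 ?mul0mx //.
    by apply: contra ne => /eqP e; apply/eqP/val_inj.
  apply: eq_bigr => k _; apply: eq_bigl => l; lia.
transitivity (\sum_(s : splitting m) \sum_(i < j.+1)
   (if (mdeg (lo s) <= i)%N then F s (i - mdeg (lo s))%N (j - i)%N else 0)).
  by apply: eq_bigr => s _; apply: (sum_antidiagonal _ (F s) jB).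
rewrite bcoef_wserr exchange_big; apply: eq_bigr => i _ /=.
rewrite bcoefM mulmx_suml; apply: eq_bigr => s _.
rewrite big_ord_recr /= big1 ?add0r; last first.
  move=> i' _; rewrite [bcoef expz _ _]bser_ofK.
  by case: eqP => [?|]; rewrite ?mulmx0 //; have := ltn_ord i'; lia.
rewrite !bser_ofK subnn eqxx /F; case: ifP => // _.
by rewrite !mul0mx.
Qed.

Lemma birkhoff_coef_eq0 (P : nat -> T) A m n : (mdeg m)%:Z < n ->
  birkhoff_coef P A n m = 0.
Proof.
move=> mn; rewrite /birkhoff_coef big1 // => q _; rewrite big1 // => k _.
rewrite big1 // => l /eqP e.
rewrite [tmx_coef _ _]tcoefM_constr tcoefM big1 ?mul0mx // => s _.
rewrite [tcoef (exp_zt _ _ _) _]exp_zt_homogeneous ?mulmx0 //.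
have := mdeg_split s; apply: contra_eq_neq => e'; lia.
Qed.

Lemma birkhoff_negseries A (P Psi : nat -> T) : birkhoff A P Psi ->
  [/\ supp (@negz N) (negseries P - 1),
      supp (@posz N) (negseries P * expz * wser U A)
    & Psi = zcoef (negseries P * expz * wser U A)].
Proof.
move=> [P0 PPsi]; split.
- move=> m j; rewrite /negz -leqNgt => jm; rewrite bcoefB bser_ofK bcoef1; case: leqP => mj.
    have -> : (j = mdeg m)%N by lia.
    by rewrite subnn P0 tcoef1 mdeg_eq0 andbb subrr.
  by case: eqP => [m0|_]; rewrite ?subrr //; move: mj; rewrite m0 mdeg0.
- move=> m j; rewrite /posz -ltnNge => mj.
  rewrite -(@birkhoff_coef_bser P A m (Negz (j - mdeg m).-1)) ?PPsi //; lia.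
- apply/funext => k; apply/tcoefP => m; rewrite tcoef_zcoef; case: leqP => km.
    rewrite -(@birkhoff_coef_bser P A m k%:Z) ?PPsi //; lia.
  by have := PPsi k m; rewrite birkhoff_coef_eq0 //; lia.
Qed.

Lemma birkhoff_of_series A (P Psi : U) :
  supp (@negz N) (P - 1) -> supp (@posz N) Psi -> P * expz * wser U A = Psi ->
  birkhoff A (fun k => tser_of (fun m => bcoef P m (mdeg m + k))) (zcoef Psi).
Proof.
move=> SP SPsi PPsi; set P' := (fun k => _).
have PE : negseries P' = P.
  apply: bcoefP => m j; rewrite bser_ofK; case: leqP => mj; first by rewrite tser_ofK subnKC.
  have := SP m j; rewrite /negz -leqNgt bcoefB bcoef1 => /(_ (ltnW mj)).
  by case: eqP mj => [->|_ _]; [rewrite mdeg0 | rewrite subr0 => ->].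
split.
  apply/tcoefP => m; rewrite tser_ofK addn0 tcoef1.
  have := SP m (mdeg m); rewrite /negz ltnn bcoefB bcoef1 mdeg_eq0 andbb => /(_ isT).
  by move/eqP; rewrite subr_eq0 => /eqP.
move=> n m; case: (lerP n (mdeg m)%:Z) => nm; last first.
  rewrite birkhoff_coef_eq0 //; case: n nm => // k km.
  by rewrite [tmx_coef _ _]tcoef_zcoef leqNgt; have -> : (mdeg m < k)%N by lia.
rewrite (@birkhoff_coef_bser P' A m n `|(mdeg m)%:Z - n|%N); last by lia.
rewrite PE PPsi; case: n nm => k nm.
  rewrite [tmx_coef _ _]tcoef_zcoef; have -> : (k <= mdeg m)%N by lia.
  by congr (bcoef _ _ _); lia.
by rewrite SPsi // /posz -ltnNge; lia.
Qed.

(** Any factorization found in the ring of series computes [Psi_plus]: two of them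
    differ by some [Q] negative in [z] with [Q E A] nonnegative. *)
Lemma Psi_plusE A (P Psi : U) : A 0%N \in unitmx ->
  supp (@negz N) (P - 1) -> supp (@posz N) Psi -> P * expz * wser U A = Psi ->
  Psi_plus A = zcoef Psi.
Proof.
move=> uA SP SPsi PPsi; apply: xget_unique => /=.
  by exists (fun k => tser_of (fun m => bcoef P m (mdeg m + k))); apply: birkhoff_of_series.
move=> Psi' [P' /birkhoff_negseries[SP' SPsi' ->]].
suff -> : negseries P' = P by rewrite PPsi.
apply/eqP; rewrite -subr_eq0; apply/eqP.
apply: (birkhoff_unique (mulmxV uA) supp_expz1).
  have -> : negseries P' - P = (negseries P' - 1) - (P - 1).
    by rewrite opprB addrA subrK.
  exact: suppB.
rewrite !mulrBl PPsi; exact: suppB.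
Qed.

(** [Psi_minus] is the inverse of [Psi_plus] evaluated at [-z].  A left inverse is
    determined recursively because the constant coefficient of [Psi_plus] is
    invertible. *)
Lemma Psi_minusE A (phi : nat -> T) :
  (forall k, \sum_(i < k.+1) phi i *m Psi_plus A (k - i)%N = if k == 0%N then 1%:M else 0) ->
  Psi_plus A 0%N *m phi 0%N = 1%:M ->
  Psi_minus A = (fun k => (-1) ^+ k *: phi k).
Proof.
move=> phiPsi Psi0; apply: xget_unique => /=.
  move=> k; rewrite -[RHS]phiPsi; apply: eq_bigr => i _.
  by rewrite -scalemxAl scalerA -exprD addnn -mul2n exprM sqrrN expr1n expr1n scale1r.
move=> f fP; apply/funext; elim/ltn_ind => k IH.
have := fP k; rewrite -[RHS]phiPsi !big_ord_recr /= subnn.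
rewrite (eq_bigr (fun i : 'I_k => phi i *m Psi_plus A (k - i)%N)); last first.
  move=> i _; rewrite IH // -scalemxAl scalerA -exprD addnn -mul2n exprM.
  by rewrite sqrrN expr1n expr1n scale1r.
move/addrI => e.
have {}e : (-1) ^+ k *: f k = phi k.
  by rewrite -[LHS]mulmx1 -[RHS]mulmx1 -Psi0 !mulmxA -scalemxAl e.
by rewrite -e scalerA -exprD addnn -mul2n exprM sqrrN expr1n expr1n scale1r.
Qed.

End WaveFunctions.

(** * The variation of the tower *)

Lemma sum_triangle (V : nmodType) l (G : nat -> nat -> V) :
  \sum_(n < l) \sum_(p < n.+1) G p (n - p)%N = \sum_(p < l) \sum_(q < l - p) G p q.
Proof.
elim: l => [|l IH]; first by rewrite !big_ord0.
rewrite big_ord_recr /= IH [in RHS]big_ord_recr /= subSn // subnn.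
rewrite [in LHS]big_ord_recr /= addrA subnn; congr (_ + _); last by rewrite big_ord1.
rewrite -big_split /=; apply: eq_bigr => p _.
by rewrite subSn 1?ltnW // big_ord_recr.
Qed.

Section TowerAlgebra.
Variables (K : pzRingType) (psi phi X : nat -> K) (r : K) (l : nat).

(** [sum_(a, b) (tower_sum a b) x^a y^b] is [(phi(x) psi(y) - 1) / (x - y)], that
    is, the tower up to the sign [(-1)^(a + 1)]. *)
Definition tower_sum a b : K := \sum_(i < b.+1) phi (a + b + 1 - i)%N * psi i.

Hypothesis l_gt0 : (0 < l)%N.
Hypothesis phi_psi : forall k, \sum_(i < k.+1) phi i * psi (k - i)%N = (k == 0%N)%:R.
Hypothesis XE : forall k, X k = \sum_(i < k.+1) psi i * r * phi (k - i)%N.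
Hypothesis X_psi : forall k, \sum_(i < k.+1) X i * psi (k - i)%N = psi k * r.
Hypothesis phi_X : forall k, \sum_(i < k.+1) phi i * X (k - i)%N = r * phi k.

(** The tower, with both indices shifted by one and extended to the boundary
    values of the indices, so that [tower_ext_diff] holds without exception. *)
Definition tower_ext a b : K := - \sum_(q < a) phi q * psi (a + b - 1 - q)%N.

Lemma tower_ext0 b : tower_ext 0 b = 0. Proof. by rewrite /tower_ext big_ord0 oppr0. Qed.

Lemma tower_extS0 a : tower_ext a.+1 0 = - (a == 0%N)%:R.
Proof. by rewrite /tower_ext -phi_psi addn0 subn1. Qed.

(** The terms of [phi psi] in a positive degree add up to [0], so a partial sum is
    minus the complementary one. *)
Lemma tower_extE a b : tower_ext a.+1 b.+1 = tower_sum a b.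
Proof.
have := phi_psi (a + b).+1; rewrite -addSn -addnS big_split_ord /= => e.
have -> : tower_sum a b = \sum_(i < b.+1) phi (a.+1 + i)%N * psi (a.+1 + b - (a.+1 + i))%N.
  rewrite /tower_sum (reindex_inj rev_ord_inj) /=; apply: eq_bigr => i _.
  by have ib := ltn_ord i; congr (phi _ * psi _); lia.
apply/eqP; rewrite eq_sym -addr_eq0 addrC -[X in _ == X]e; apply/eqP.
congr (_ + _); apply: eq_bigr => i _; congr (_ * psi _); lia.
Qed.

Lemma tower_ext_diff a b : tower_ext a b.+1 - tower_ext a.+1 b = phi a * psi b.
Proof.
rewrite /tower_ext big_ord_recr /= opprK addnS addSn subn1 /= addKn addrA.
by rewrite addNr add0r.
Qed.

(** The variations [(z^-l X)_+ psi] and [- phi (z^-l X)_+] of [psi] and [phi],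
    for [X = psi r phi]. *)
Definition psi_var k : K := \sum_(i < k.+1) X (i + l)%N * psi (k - i)%N.
Definition phi_var k : K := - \sum_(i < k.+1) phi i * X (k - i + l)%N.

(** The sum defining [psi_var k] is the coefficient [psi_(k+l) r] of [X psi] in
    degree [k + l] without the terms involving [X_n], [n < l]. *)
Lemma psi_varE k : psi_var k =
  psi (k + l)%N * r + \sum_(i < l) psi i * r * tower_ext (l - i)%N k.+1.
Proof.
have := X_psi (l + k); rewrite -addnS big_split_ord /= [(k + l)%N]addnC => <-.
have -> : psi_var k = \sum_(i < k.+1) X (l + i)%N * psi (l + k - (l + i))%N.
  by apply: eq_bigr => i _; rewrite subnDl addnC.
rewrite addrAC -[LHS]add0r; congr (_ + _); apply/esym.
have -> : \sum_(i < l) X i * psi (l + k - i)%N =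
    \sum_(n < l) \sum_(p < n.+1) psi p * r * (phi (n - p)%N * psi (l + k - p - (n - p))%N).
  apply: eq_bigr => n _; rewrite XE mulr_suml; apply: eq_bigr => p _.
  by rewrite mulrA; congr (_ * psi _); have := ltn_ord p; lia.
rewrite (sum_triangle l (fun p q => psi p * r * (phi q * psi (l + k - p - q)%N))).
rewrite -big_split big1 //= => i _; rewrite /tower_ext mulrN -mulr_sumr.
apply/eqP; rewrite subr_eq0; apply/eqP; congr (_ * _).
by apply: eq_bigr => q _; congr (_ * psi _); have := ltn_ord i; lia.
Qed.

Lemma phi_varE k : phi_var k =
  - (r * phi (k + l)%N) + \sum_(i < l) tower_ext k.+1 i.+1 * r * phi (l - 1 - i)%N.
Proof.
have := phi_X (k + l); rewrite -addSn big_split_ord /= => <-.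
have -> : phi_var k = - \sum_(i < k.+1) phi i * X (k + l - i)%N.
  congr (- _); apply: eq_bigr => i _; congr (_ * X _); have := ltn_ord i; lia.
rewrite opprD -addrA -[LHS]addr0; congr (_ + _); apply/esym.
apply/eqP; rewrite addrC subr_eq0; apply/eqP/esym.
rewrite (reindex_inj rev_ord_inj) /=.
have -> : \sum_(i < l) phi (k.+1 + (l - i.+1))%N * X (k + l - (k.+1 + (l - i.+1)))%N =
    \sum_(n < l) \sum_(p < n.+1) phi (k + l - p - (n - p))%N * psi (n - p)%N * r * phi p.
  apply: eq_bigr => n _.
  have -> : (k + l - (k.+1 + (l - n.+1)))%N = n by have := ltn_ord n; lia.
  rewrite XE mulr_sumr (reindex_inj rev_ord_inj) /=; apply: eq_bigr => p _.
  have := ltn_ord p; have := ltn_ord n => ln lp; rewrite !mulrA.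
  by congr (phi _ * psi _ * _ * phi _); lia.
rewrite (sum_triangle l (fun p q => phi (k + l - p - q)%N * psi q * r * phi p)).
rewrite [RHS](reindex_inj rev_ord_inj) /=; apply: eq_bigr => i _; have il := ltn_ord i.
have -> : (l - i.+1).+1 = (l - i.+1 + 1)%N by rewrite addn1.
rewrite addn1 tower_extE /tower_sum -subSn // subSS mulr_suml mulr_suml.
apply: eq_bigr => p _; have := ltn_ord p => lp.
by congr (phi _ * _ * _ * phi _); lia.
Qed.

(** Each summand of the variation of [tower_sum a b] beyond the terms linear in the
    tower is, by [tower_ext_diff], a difference of values of this quadratic form. *)
Definition tower_quad a b : K := \sum_(i < l) tower_ext a i.+1 * r * tower_ext (l - i)%N b.

Lemma tower_quad_diff a c : (0 < a)%N ->
  (\sum_(i < l) tower_ext a.+1 i.+1 * r * phi (l - 1 - i)%N) * psi c +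
  phi a * (\sum_(i < l) psi i * r * tower_ext (l - i)%N c.+1) =
  tower_quad a c.+1 - tower_quad a.+1 c.
Proof.
move=> a0; pose g i := tower_ext a.+1 i * r * tower_ext (l - i)%N c.+1.
have g0 : \sum_(i < l) (g i.+1 - g i) = 0.
  have := telescope_sumr g (leq0n l); rewrite big_mkord => ->.
  rewrite /g subnn tower_ext0 mulr0 tower_extS0.
  by case: (a) a0 => // a' _; rewrite oppr0 !mul0r subrr.
apply: (addIr (\sum_(i < l) (g i.+1 - g i))); rewrite {1}g0 addr0.
rewrite mulr_suml mulr_sumr -big_split /= /tower_quad -sumrB -big_split /=.
apply: eq_bigr => i _; have il := ltn_ord i.
have E1 : phi (l - 1 - i)%N * psi c = tower_ext (l - 1 - i) c.+1 - tower_ext (l - i) c.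
  by rewrite -tower_ext_diff; congr (_ - tower_ext _ _); lia.
rewrite -[_ * psi c]mulrA E1 !mulrA -tower_ext_diff !(mulrBl, mulrBr) /g.
have -> : (l - i.+1 = l - 1 - i)%N by lia.
by rewrite addrACA [RHS]addrACA; congr (_ + _); apply: addrC.
Qed.

(** The quadratic terms telescope along the summation index of the tower.  Their
    boundary value is linear in the tower and completes the truncated sum in
    [tower_sum a (b + l) * r]. *)
Lemma tower_variation a b :
  \sum_(i < b.+1) (phi_var (a + b + 1 - i)%N * psi i + phi (a + b + 1 - i)%N * psi_var i) =
  - (r * tower_sum (a + l) b) + tower_sum a (b + l) * r
  + \sum_(i < l) tower_sum a i * r * tower_sum (l - 1 - i)%N b.
Proof.
(* The [i]-th term contributes [h i.+1 - h i] to the quadratic part. *)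
pose h c := tower_quad (a + b + 2 - c)%N c.
have -> : \sum_(i < b.+1)
    (phi_var (a + b + 1 - i)%N * psi i + phi (a + b + 1 - i)%N * psi_var i) =
  \sum_(i < b.+1) (- (r * (phi (a + b + 1 - i + l)%N * psi i)) +
     phi (a + b + 1 - i)%N * psi (i + l)%N * r + (h i.+1 - h i)).
  apply: eq_bigr => i _; have ib := ltn_ord i; rewrite phi_varE psi_varE.
  have e1 : (a + b + 2 - i.+1 = a + b + 1 - i)%N by lia.
  have e2 : (a + b + 2 - i = (a + b + 1 - i).+1)%N by lia.
  rewrite /h e1 e2 -tower_quad_diff; last by lia.
  by rewrite mulrDl mulrDr addrACA mulNr !mulrA.
rewrite big_split big_split [X in _ + X = _](_ : _ = h b.+1 - h 0%N); last first.
  by have := telescope_sumr h (leq0n b.+1); rewrite big_mkord => ->.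
have -> : h b.+1 = \sum_(i < l) tower_sum a i * r * tower_sum (l - 1 - i)%N b.
  rewrite /h /tower_quad; apply: eq_bigr => i _; have il := ltn_ord i.
  have -> : (a + b + 2 - b.+1 = a.+1)%N by lia.
  have -> : (l - i = (l - 1 - i).+1)%N by lia.
  by rewrite !tower_extE.
have -> : h 0%N = - (tower_sum (a + b + 1) (l - 1) * r).
  rewrite /h /tower_quad; case: (l) l_gt0 => // l' _; rewrite big_ord_recr /= big1; last first.
    move=> i _; have := ltn_ord i => il.
    have -> : (l'.+1 - i = (l' - i).+1)%N by lia.
    rewrite tower_extS0; case: eqP => [|_]; last by rewrite oppr0 mulr0.
    by lia.
  rewrite subSn // subnn tower_extS0 eqxx add0r mulrN mulr1; congr (- (_ * _)).
  by rewrite subn0 subn1 /= addn2 addn1 tower_extE.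
rewrite opprK -!addrA; congr (_ + _).
  rewrite sumrN /tower_sum mulr_sumr; congr (- _); apply: eq_bigr => i _.
  by congr (_ * (phi _ * _)); have := ltn_ord i; lia.
rewrite addrCA [RHS]addrC; congr (_ + _); rewrite -mulr_suml -mulrDl; congr (_ * _).
rewrite addrC /tower_sum -[(b + l)%N]addnC -addnS big_split_ord /=; congr (_ + _).
  have -> : (l - 1).+1 = l by lia.
  by apply: eq_bigr => i _; congr (phi _ * _); lia.
by apply: eq_bigr => i _; congr (phi _ * psi _); have ib := ltn_ord i; lia.
Qed.

End TowerAlgebra.

(** * Derivatives of polynomial functions *)

(** Stated over any field with a norm, hence for the complex derivative. *)
Lemma is_derive_horner (C : numFieldType) (p : {poly C}) (x : C) :
  is_derive (x : C) (1 : C) (horner p : C -> C) p^`().[x].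
Proof.
elim/poly_ind: p => [|p c IH].
  rewrite deriv0 horner0 (_ : horner 0 = cst 0); first exact: is_derive_cst.
  by apply/funext => y; rewrite horner0.
rewrite (_ : horner _ = (horner p : C -> C) * id + cst c :> (C -> C)); last first.
  by apply/funext => y; rewrite hornerMXaddC.
have D := is_deriveD (is_deriveM IH (is_derive_id x 1)) (is_derive_cst c x 1).
apply: (is_derive_eq D).
by rewrite derivMXaddC hornerD hornerM hornerX addr0 /GRing.scale /= mulr1 [x * _]mulrC.
Qed.

Lemma derive1_horner0 (C : numFieldType) (p : {poly C}) :
  derivable (horner p : C -> C) 0 1 /\ derive1 (horner p : C -> C) 0 = p`_1.
Proof.
have [D E] := is_derive_horner p 0; split => //.
by rewrite derive1E E horner_coef0 coef_deriv.
Qed.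

(** * First-order variations *)

Section Variations.
Variables (R S : comNzRingType).

(** [c1] sends [x0 + x1 eps + ...] to [x1], and [c0] to [x0]. *)
Definition mx_leibniz n (c1 c0 : R -> S) := forall A B : 'M[R]_n,
  map_mx c1 (A *m B) = map_mx c1 A *m map_mx c0 B + map_mx c0 A *m map_mx c1 B.

Variables (N n : nat) (U : bseries N n R) (V : bseries N n S).

Definition mapU (g : R -> S) (X : U) : V := bser_of V (fun m j => map_mx g (bcoef X m j)).
Definition mapT (g : R -> S) (X : 'M[fps N R]_n) : 'M[fps N S]_n :=
  tser_of (fun m => map_mx g (tcoef X m)).

Section Additive.
Variable g : {additive R -> S}.

Lemma mapUB X Y : mapU g (X - Y) = mapU g X - mapU g Y.
Proof. by apply: bcoefP => m j; rewrite bcoefB !bser_ofK bcoefB map_mxB. Qed.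

Lemma supp_mapU (T : mono N -> nat -> bool) X : supp T X -> supp T (mapU g X).
Proof. by move=> TX m j /TX; rewrite bser_ofK => ->; rewrite map_mx0. Qed.

Lemma mapU_wser a : mapU g (wser U a) = wser V (fun j => map_mx g (a j)).
Proof.
apply: bcoefP => m j; rewrite !bser_ofK (fun_if (map_mx g)).
by case: ifP; rewrite ?map_mx0.
Qed.

Lemma zcoef_mapU X k : zcoef (mapU g X) k = mapT g (zcoef X k).
Proof.
apply/tcoefP => m; rewrite tcoef_zcoef [RHS]tser_ofK tcoef_zcoef (fun_if (map_mx g)) bser_ofK.
by case: ifP; rewrite ?map_mx0.
Qed.

Lemma mapT_sum I (s : seq I) (P : pred I) F :
  mapT g (\sum_(i <- s | P i) F i) = \sum_(i <- s | P i) mapT g (F i).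
Proof.
apply/tcoefP => m; rewrite tser_ofK !tcoef_sum raddf_sum.
by apply: eq_bigr => i _; rewrite tser_ofK.
Qed.

Lemma mapTN X : mapT g (- X) = - mapT g X.
Proof.
by apply/tcoefP => m; rewrite tser_ofK !tcoefN tser_ofK map_mxN.
Qed.

Lemma mapT_sign k X : mapT g ((-1) ^+ k *: X) = (-1) ^+ k *: mapT g X.
Proof. by rewrite -signr_odd -[in RHS]signr_odd !scaler_sign -mapTN; case: (odd k). Qed.

End Additive.

Lemma mapUM (g : {rmorphism R -> S}) X Y : mapU g (X * Y) = mapU g X * mapU g Y.
Proof.
apply: bcoefP => m j; rewrite bser_ofK !bcoefM raddf_sum; apply: eq_bigr => s _.
by rewrite raddf_sum; apply: eq_bigr => i _; rewrite !bser_ofK -map_mxM.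
Qed.

Lemma mapU1 (g : {rmorphism R -> S}) : mapU g 1 = 1.
Proof.
by apply: bcoefP => m j; rewrite bser_ofK !bcoef1 (fun_if (map_mx g)) map_mx1 map_mx0.
Qed.

Lemma mapTM (g : {rmorphism R -> S}) X Y : mapT g (X *m Y) = mapT g X *m mapT g Y.
Proof.
apply/tcoefP => m; rewrite tser_ofK !tcoefM raddf_sum; apply: eq_bigr => s _.
by rewrite !tser_ofK -map_mxM.
Qed.

Section Leibniz.
Variables (c1 c0 : {additive R -> S}).
Hypothesis c1L : mx_leibniz n c1 c0.

Lemma mapU_leibniz X Y :
  mapU c1 (X * Y) = mapU c1 X * mapU c0 Y + mapU c0 X * mapU c1 Y.
Proof.
apply: bcoefP => m j; rewrite bser_ofK bcoefD !bcoefM raddf_sum -big_split.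
apply: eq_bigr => s _; rewrite raddf_sum -big_split; apply: eq_bigr => i _.
by rewrite !bser_ofK; exact: c1L.
Qed.

Lemma mapT_leibniz X Y :
  mapT c1 (X *m Y) = mapT c1 X *m mapT c0 Y + mapT c0 X *m mapT c1 Y.
Proof.
apply/tcoefP => m; rewrite tser_ofK tcoefD !tcoefM raddf_sum -big_split.
by apply: eq_bigr => s _; rewrite !tser_ofK; exact: c1L.
Qed.
End Leibniz.

End Variations.

Lemma coefp1_leibniz (R : comNzRingType) n :
  mx_leibniz n (coefp 1 : {poly R} -> R) (horner_eval 0).
Proof.
move=> A B; apply/matrixP => a b; rewrite !mxE raddf_sum -big_split /=.
apply: eq_bigr => d _; rewrite !mxE /= /horner_eval !horner_coef0.
by rewrite coefM !big_ord_recl big_ord0 addr0 addrC.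
Qed.

(** * The infinitesimal action on wave functions *)

Section WaveVariation.
Variables (N n : nat) (R : comNzRingType) (U : bseries N n R).
Variables (a : nat -> 'M[R]_n) (a0' : 'M[R]_n) (E : U).
Hypothesis a0K : a 0%N *m a0' = 1%:M.
Hypothesis E1 : supp (fun m _ => 0 < mdeg m)%N (E - 1).
Local Notation A := (wser U a).

(** Multiplied by [Phi = Psi^-1], the variation reads
    [dPsi Phi = dP P^-1 + Psi rw Phi], where [dP P^-1] is negative and the left-hand
    side is nonnegative, hence equal to [(Psi rw Phi)_+].  To avoid inverting [P],
    uniqueness is applied to [Q = dP + (Psi rw Phi)_- P]: it is negative and
    [Q E A = dPsi - (Psi rw Phi)_+ Psi] is nonnegative, so both vanish. *)
Lemma wave_variation (P Psi Phi dP dPsi rw : U) :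
  supp (@negz N) (P - 1) -> supp (@posz N) Psi -> P * E * A = Psi ->
  Phi * Psi = 1 ->
  supp (@negz N) dP -> supp (@posz N) dPsi -> dPsi = dP * E * A + Psi * rw ->
  dPsi = cut (@posz N) (Psi * rw * Phi) * Psi.
Proof.
move=> SP SPsi PPsi PhiPsi SdP SdPsi dPsiE; set Z := Psi * rw * Phi.
have SZ : supp (@negz N) (Z - cut (@posz N) Z).
  by apply: suppW (supp_cutC (S := @posz N) Z) => m j; rewrite /posz -ltnNge.
have SP' : supp (@nposz N) P.
  rewrite -[P](subrK 1); apply: suppD; last by apply: supp_1; rewrite /nposz mdeg0.
  by apply: suppW SP => m j; apply: ltnW.
pose Q := dP + (Z - cut (@posz N) Z) * P.
have QE : Q * E * A = dPsi - cut (@posz N) Z * Psi.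
  have -> : Q * E * A = dP * E * A + (Z - cut (@posz N) Z) * (P * E * A).
    by rewrite !mulrA -!mulrDl.
  by rewrite PPsi mulrBl addrA dPsiE /Z -[Psi * rw * Phi * Psi]mulrA PhiPsi mulr1.
have Q0 : Q = 0.
  apply: (birkhoff_unique a0K E1); first by apply: suppD => //; apply: supp_negM.
  by rewrite QE; apply: suppB => //; apply: supp_posM => //; apply: supp_cut.
by apply/eqP; rewrite -subr_eq0 -QE Q0 !mul0r.
Qed.

End WaveVariation.

(** * The orbit of the tower *)

(** With [Psi_minus] equal to [(-1)^k phi_k], all signs in the definition of
    [tower B a b] reduce to [(-1)^(a + 1)]. *)
Lemma towerE (N : nat) (C : numFieldType) (U : bseries N N C) (B : zmx N C)
    (Psi Phi : U) a b :
  supp (@posz N) Psi -> supp (@posz N) Phi -> Phi * Psi = 1 ->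
  Psi_plus B = zcoef Psi ->
  tower B a b = (-1) ^+ a.+1 *: (tower_sum (zcoef Psi : nat -> ('M[fps N C]_N : pzRingType)) (zcoef Phi) a b :
    'M[fps N C]_N).
Proof.
move=> SPsi SPhi PhiPsi PB.
have PM : Psi_minus B = (fun k => (-1) ^+ k *: zcoef Phi k).
  apply: Psi_minusE => [k|]; rewrite PB; first by rewrite -zcoefM // PhiPsi zcoef1.
  have := @zcoefM _ _ _ _ Psi Phi 0 SPsi SPhi.
  by rewrite (bser_mul1C PhiPsi) zcoef1 big_ord1 subnn => <-.
rewrite /tower PM PB /tower_sum scaler_sumr; apply: eq_bigr => i _.
rewrite -scalemxAl scalerA -exprD; congr (_ *: _).
rewrite -signr_odd -[RHS]signr_odd; congr (_ ^+ nat_of_bool _).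
have := ltn_ord i; lia.
Qed.

Section ExpFamily.
Variables (N : nat) (C : numFieldType) (f : zmx N C).

Lemma zmx_powS (g : zmx N C) k n :
  zmx_pow g k.+1 n = \sum_(i < n.+1) g i *m zmx_pow g k (n - i)%N.
Proof. by []. Qed.

Lemma zmx_pow_scale (e : C) k n :
  zmx_pow (fun j => e *: f j) k n = e ^+ k *: zmx_pow f k n.
Proof.
elim: k n => [|k IH] n; first by rewrite expr0 scale1r.
rewrite !zmx_powS scaler_sumr; apply: eq_bigr => i _.
by rewrite IH -scalemxAl -scalemxAr scalerA exprS.
Qed.

(** The coefficient of [z^n] in [exp (eps f(z))], polynomial in [eps]. *)
Definition exp_eps (n : nat) : 'M[{poly C}]_N :=
  \sum_(k < n.+1) ((k`!%:R)^-1 *: 'X^k) *: map_mx polyC (zmx_pow f k n).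

Lemma exp_eps_eval e n :
  map_mx (horner_eval e) (exp_eps n) = zmx_exp (fun j => e *: f j) n.
Proof.
rewrite raddf_sum; apply: eq_bigr => k _; apply/matrixP => i j.
rewrite zmx_pow_scale !mxE /= /horner_eval hornerM hornerZ hornerXn hornerC.
by rewrite mulrA.
Qed.

Lemma exp_eps_eval0 n : map_mx (horner_eval 0) (exp_eps n) = zmx_one N C n.
Proof.
rewrite exp_eps_eval /zmx_exp big_ord_recl fact0 invr1 scale1r big1 ?addr0 // => k _.
by rewrite (zmx_pow_scale 0 k.+1) exprS mul0r scale0r scaler0.
Qed.

Lemma exp_eps_coef1 n : f 0%N = 0 -> map_mx (coefp 1) (exp_eps n) = f n.
Proof.
move=> f0; rewrite raddf_sum.
have E k : map_mx (coefp 1) (((k`!%:R)^-1 *: 'X^k) *: map_mx polyC (zmx_pow f k n)) =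
    if k == 1%N then f n else 0.
  apply/matrixP => i j; rewrite !mxE /= coefMC coefZ coefXn eq_sym.
  case: eqP => [->|_]; last by rewrite mulr0 mul0r mxE.
  rewrite invr1 !mul1r zmx_powS summxE big_ord_recr /= subnn /zmx_one /= mulmx1.
  rewrite big1 ?add0r // => q _; rewrite subn_eq0 leqNgt ltn_ord /=.
  by rewrite mulmx0 mxE.
transitivity (\sum_(k < n.+1) (if (k : nat) == 1%N then f n else 0)).
  by apply: eq_bigr => k _; apply: E.
case: n {E} => [|n].
  by rewrite big_ord1 /= f0.
by rewrite big_ord_recl big_ord_recl /= add0r big1 ?addr0.
Qed.

End ExpFamily.

Section Orbit.
Variables (N : nat) (C : numFieldType) (A f : zmx N C).
Hypothesis uA : A 0%N \in unitmx.
Hypothesis f0 : f 0%N = 0.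
Local Notation U := (bser_model N N {poly C}).
Local Notation V := (bser_model N N C).
Local Notation T := ('M[fps N C]_N : pzRingType).
Local Notation TP := ('M[fps N {poly C}]_N : pzRingType).
Local Notation ev e := (horner_eval e : {poly C} -> C).
Local Notation d1 := (coefp 1 : {poly C} -> C).
Local Notation orbit e := (zmx_mul A (zmx_exp (fun n => e *: f n))).

Definition orbit_eps (n : nat) : 'M[{poly C}]_N :=
  \sum_(i < n.+1) map_mx polyC (A i) *m exp_eps f (n - i).

Lemma map_polyCK e (X : 'M[C]_N) : map_mx (ev e) (map_mx polyC X) = X.
Proof. by apply/matrixP => p q; rewrite !mxE /= /horner_eval hornerC. Qed.

Lemma map_polyC_coef1 (X : 'M[C]_N) : map_mx d1 (map_mx polyC X) = 0.
Proof. by apply/matrixP => p q; rewrite !mxE /= coefC. Qed.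

Lemma orbit_eps_eval e n : map_mx (ev e) (orbit_eps n) = orbit e n.
Proof.
rewrite raddf_sum; apply: eq_bigr => i _ /=.
by rewrite map_mxM map_polyCK exp_eps_eval.
Qed.

Lemma orbit_eps_eval0 n : map_mx (ev 0) (orbit_eps n) = A n.
Proof.
rewrite raddf_sum big_ord_recr /= big1 ?add0r => [|i _].
  by rewrite map_mxM exp_eps_eval0 subnn mulmx1 map_polyCK.
rewrite map_mxM exp_eps_eval0 /zmx_one subn_eq0 leqNgt ltn_ord /=.
by rewrite mulmx0.
Qed.

Lemma orbit_eps0 : orbit_eps 0 = map_mx polyC (A 0%N).
Proof.
rewrite /orbit_eps big_ord1 /exp_eps big_ord1 fact0 invr1 expr0 !scale1r.
by rewrite map_mx1 mulmx1.
Qed.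

Lemma orbit_eps_coef1 n : map_mx d1 (orbit_eps n) = zmx_mul A f n.
Proof.
rewrite raddf_sum; apply: eq_bigr => i _.
apply: (etrans (coefp1_leibniz _ _)).
rewrite map_polyCK exp_eps_coef1 //.
by rewrite map_polyC_coef1 mul0mx add0r.
Qed.

(** The factorization is carried out over the ring of polynomials in [eps]: this is
    why the coefficients of the wave functions, hence of the tower, depend
    polynomially on [eps] along the orbit. *)
Lemma orbit_factorization : exists P Psi Phi : U,
  [/\ supp (@negz N) (P - 1), supp (@posz N) Psi, supp (@posz N) Phi, Phi * Psi = 1 &
      P * mapU U polyC (expz V) * wser U orbit_eps = Psi].
Proof.
have e0K : orbit_eps 0 *m map_mx polyC (invmx (A 0%N)) = 1%:M.
  by rewrite orbit_eps0 -map_mxM mulmxV // map_mx1.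
have SE : supp (fun m _ => 0 < mdeg m)%N (mapU U polyC (expz V) - 1).
  by rewrite -(mapU1 V U polyC) -mapUB; apply: supp_mapU; apply: supp_expz1.
have [P [Psi [SP SPsi PPsi Psi0]]] := birkhoff_exists e0K SE.
have [|Phi [PsiPhi SPhi]] := @bser_inverse _ _ _ U Psi (map_mx polyC (invmx (A 0%N))).
  by rewrite Psi0.
exists P, Psi, Phi; split => //; last exact: bser_mul1C.
apply: SPhi => // m1 j1 m2 j2 h1 h2; rewrite /posz mdegD.
exact: leq_add.
Qed.

(** Evaluation at a value of [eps] is a ring morphism that respects supports, so it
    maps the factorization over polynomials to a factorization. *)
Lemma orbit_wave e (P Psi : U) (B : zmx N C) :
  (forall n, map_mx (ev e) (orbit_eps n) = B n) ->
  supp (@negz N) (P - 1) -> supp (@posz N) Psi ->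
  P * mapU U polyC (expz V) * wser U orbit_eps = Psi ->
  mapU V (ev e) P * expz V * wser V B = mapU V (ev e) Psi /\
  Psi_plus B = zcoef (mapU V (ev e) Psi).
Proof.
move=> eB SP SPsi PPsi.
have PV : mapU V (ev e) P * expz V * wser V B = mapU V (ev e) Psi.
  rewrite -PPsi !mapUM mapU_wser.
  have -> : (fun j => map_mx (ev e) (orbit_eps j)) = B by apply/funext.
  congr (_ * _ * _); apply: bcoefP => m j.
  by rewrite !bser_ofK map_polyCK.
split => //; apply: Psi_plusE PV.
- by rewrite -eB orbit_eps0 map_polyCK.
- by rewrite -(mapU1 U V (ev e)) -mapUB; apply: supp_mapU.
- exact: supp_mapU.
Qed.

End Orbit.

(** * The infinitesimal action on the tower *)

Section ZVariation.
Variables (N n : nat) (R : comNzRingType) (U : bseries N n R).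
Local Notation T := ('M[fps N R]_n : pzRingType).
Local Notation pos := (@posz N).
Variables (l : nat) (r : 'M[R]_n) (Psi Phi dPsi dPhi : U).
Hypothesis l_gt0 : (0 < l)%N.
Hypothesis SPsi : supp pos Psi.
Hypothesis SPhi : supp pos Phi.
Hypothesis PhiPsi : Phi * Psi = 1.
Hypothesis dPsiE : dPsi = cut pos (Psi * (bconst U r * wpow U l) * Phi) * Psi.
Hypothesis dPhiE : dPhi * Psi + Phi * dPsi = 0.

Let rc : T := map_mx (@fps_const N R) r.
Let X : U := Psi * bconst U r * Phi.

Lemma zcoefM_constr (Y : U) k : zcoef (Y * bconst U r) k = (zcoef Y k : T) * rc.
Proof.
apply/tcoefP => m; rewrite tcoefM_constr !tcoef_zcoef bcoef_wserr.
case: ifP => _; last by rewrite mul0mx.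
rewrite big_ord_recr /= subnn eqxx big1 ?add0r // => i _.
by rewrite subn_eq0 leqNgt ltn_ord mulmx0.
Qed.

Lemma supp_pos_const : supp pos (bconst U r).
Proof. exact: supp_bconstW. Qed.

Lemma zcoefM_constl (Y : U) k : supp pos Y -> zcoef (bconst U r * Y) k = rc * (zcoef Y k : T).
Proof.
move=> SY; rewrite (zcoefM _ supp_pos_const SY) big_ord_recl zcoef_const eqxx subn0 big1 ?addr0 // => i _.
by rewrite zcoef_const mul0mx.
Qed.

Lemma supp_posX : supp pos X.
Proof. by apply: supp_posM SPhi; apply: supp_posM supp_pos_const. Qed.

Lemma cutXE : cut pos (Psi * (bconst U r * wpow U l) * Phi) = cut pos (X * wpow U l).
Proof. by rewrite /X -!mulrA wpowC !mulrA. Qed.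

Lemma zcoef_dPsi k :
  zcoef dPsi k = psi_var (zcoef Psi : nat -> T) (zcoef X) l k.
Proof.
rewrite dPsiE cutXE (zcoefM _ (@supp_cut _ _ _ _ pos _) SPsi).
by apply: eq_bigr => i _; rewrite zcoef_cut_posz zcoef_wpow.
Qed.

Lemma zcoef_dPhi k :
  zcoef dPhi k = phi_var (zcoef Phi : nat -> T) (zcoef X) l k.
Proof.
have PsiPhi := bser_mul1C PhiPsi.
have -> : dPhi = - (Phi * cut pos (X * wpow U l)).
  rewrite -[LHS]mulr1 -PsiPhi mulrA -cutXE.
  have -> : dPhi * Psi = - (Phi * dPsi) by apply/eqP; rewrite -addr_eq0 dPhiE.
  by rewrite dPsiE mulNr -!mulrA PsiPhi mulr1.
rewrite zcoefN (zcoefM _ SPhi (@supp_cut _ _ _ _ pos _)); congr (- _).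
by apply: eq_bigr => i _; rewrite zcoef_cut_posz zcoef_wpow.
Qed.

(** [tower_variation] for the coefficients of the wave functions: since [w^l] is
    [z^-l], truncating [X w^l] shifts the coefficients of [X] by [l]. *)
Lemma zcoef_tower_variation a b :
  \sum_(i < b.+1) ((zcoef dPhi (a + b + 1 - i)%N : T) * zcoef Psi i +
                   (zcoef Phi (a + b + 1 - i)%N : T) * zcoef dPsi i) =
  - (rc * tower_sum (zcoef Psi : nat -> T) (zcoef Phi) (a + l) b)
  + tower_sum (zcoef Psi : nat -> T) (zcoef Phi) a (b + l) * rc
  + \sum_(i < l) tower_sum (zcoef Psi : nat -> T) (zcoef Phi) a i * rc *
      tower_sum (zcoef Psi : nat -> T) (zcoef Phi) (l - 1 - i)%N b.
Proof.
have PsiPhi := bser_mul1C PhiPsi.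
rewrite -(@tower_variation T (zcoef Psi) (zcoef Phi) (zcoef X) rc l l_gt0).
- by apply: eq_bigr => i _; rewrite zcoef_dPhi zcoef_dPsi.
- move=> k; have := zcoefM k SPhi SPsi; rewrite PhiPsi zcoef1 => <-.
  by case: (k == 0%N).
- move=> k; rewrite /X (zcoefM _ _ SPhi); last by apply: supp_posM supp_pos_const.
  by apply: eq_bigr => i _; rewrite zcoefM_constr.
- move=> k; rewrite -zcoefM_constr; have := zcoefM k supp_posX SPsi.
  by rewrite /X -mulrA PhiPsi mulr1 => ->.
- move=> k; rewrite -zcoefM_constl //; have := zcoefM k SPhi supp_posX.
  by rewrite /X !mulrA PhiPsi mul1r => ->.
Qed.

End ZVariation.

Section Main.
Variables (N : nat) (C : numFieldType) (A : zmx N C) (r : 'M[C]_N) (l : nat).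
Hypothesis uA : A 0%N \in unitmx.
Hypothesis l_gt0 : (0 < l)%N.
Local Notation U := (bser_model N N {poly C}).
Local Notation V := (bser_model N N C).
Local Notation T := ('M[fps N C]_N : pzRingType).
Local Notation TP := ('M[fps N {poly C}]_N : pzRingType).
Local Notation ev e := (horner_eval e : {poly C} -> C).
Local Notation d1 := (coefp 1 : {poly C} -> C).
Local Notation f := (zmx_monom l r).
Local Notation orbit e := (zmx_mul A (zmx_exp (fun n => e *: f n))).
Local Notation rc := (tmx_const r : T).

Lemma wser_monom : wser V f = bconst V r * wpow V l.
Proof.
apply: bcoefP => m j; rewrite bcoef_wpow !bser_ofK /zmx_monom.
have [->|nl] := eqVneq j l; first by rewrite leqnn subnn eqxx.
rewrite !if_same; case: leqP => // lj; case: (m == 0) => //.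
by rewrite subn_eq0; case: leqP => // jl; case/eqP: nl; lia.
Qed.

Lemma mapT_tower_sum (R S : comNzRingType) n (W : bseries N n R) (W' : bseries N n S)
    (g : {rmorphism R -> S}) (Psi Phi : W) a b :
  mapT g (tower_sum (zcoef Psi : nat -> ('M[fps N R]_n : pzRingType)) (zcoef Phi) a b) =
  tower_sum (zcoef (mapU W' g Psi) : nat -> ('M[fps N S]_n : pzRingType)) (zcoef (mapU W' g Phi)) a b.
Proof.
rewrite /tower_sum mapT_sum; apply: eq_bigr => i _.
by rewrite !zcoef_mapU; apply: mapTM.
Qed.

(** [W] is the tower with coefficients polynomial in [eps]; its first-order
    coefficient in [eps] is found from that of the factorization [P E A = Psi] and of
    [Phi Psi = 1] by the Leibniz rule. *)
Lemma tower_first_order :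
  exists (W : nat -> nat -> TP) (psi phi : nat -> T),
  [/\ forall e a b, tower (orbit e) a b = mapT (ev e) (W a b),
      forall a b, tower A a b = (-1) ^+ a.+1 *: (tower_sum psi phi a b : T) &
      forall a b, mapT d1 (W a b) = (-1) ^+ a.+1 *:
        (- (rc * tower_sum psi phi (a + l) b) + tower_sum psi phi a (b + l) * rc
         + \sum_(i < l) tower_sum psi phi a i * rc * tower_sum psi phi (l - 1 - i)%N b : T)].
Proof.
have f0 : f 0%N = 0 by rewrite /zmx_monom; case: eqP l_gt0 => // <-.
have [P [Psi [Phi [SP SPsi SPhi PhiPsi PPsi]]]] := orbit_factorization f uA.
have SV (g : {additive {poly C} -> C}) S (X : U) : supp S X -> supp S (mapU V g X).
  exact: supp_mapU.
have PhiPsi_e e : mapU V (ev e) Phi * mapU V (ev e) Psi = 1.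
  by rewrite -mapUM PhiPsi mapU1.
have [P0E P0] := orbit_wave uA (orbit_eps_eval0 A f) SP SPsi PPsi.
exists (fun a b => (-1) ^+ a.+1 *: (tower_sum (zcoef Psi : nat -> TP) (zcoef Phi) a b : TP)).
exists (zcoef (mapU V (ev 0) Psi)), (zcoef (mapU V (ev 0) Phi)); split.
- move=> e a b.
  have [_ PB] := orbit_wave uA (orbit_eps_eval A f e) SP SPsi PPsi.
  rewrite (towerE a b (SV (ev e) _ _ SPsi) (SV (ev e) _ _ SPhi) (PhiPsi_e e) PB).
  by rewrite mapT_sign (mapT_tower_sum V).
- move=> a b.
  exact: (towerE a b (SV (ev 0) _ _ SPsi) (SV (ev 0) _ _ SPhi) (PhiPsi_e 0) P0).
move=> a b; rewrite mapT_sign; congr (_ *: _).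
have L := @coefp1_leibniz C N.
have d1c (X : V) : mapU V d1 (mapU U polyC X) = 0.
  by apply: bcoefP => m j; rewrite !bser_ofK map_polyC_coef1 bcoef0.
have d11 : mapU V d1 (1 : U) = 0.
  by rewrite -(mapU1 V U polyC) d1c.
have evc (X : V) : mapU V (ev 0) (mapU U polyC X) = X.
  by apply: bcoefP => m j; rewrite !bser_ofK map_polyCK.
have dPhiE : mapU V d1 Phi * mapU V (ev 0) Psi + mapU V (ev 0) Phi * mapU V d1 Psi = 0.
  by rewrite -(mapU_leibniz V L) PhiPsi d11.
have dPsi : mapU V d1 Psi = mapU V d1 P * expz V * wser V A + mapU V (ev 0) Psi * (bconst V r * wpow V l).
  rewrite -{1}PPsi !(mapU_leibniz V L) !mapUM d1c evc mulr0 addr0 !mapU_wser.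
  have -> : (fun j => map_mx (ev 0) (orbit_eps A f j)) = A.
    by apply/funext => j; apply: orbit_eps_eval0.
  have -> : (fun j => map_mx d1 (orbit_eps A f j)) = zmx_mul A f.
    by apply/funext => j; apply: orbit_eps_coef1.
  by rewrite -P0E -wser_monom -[wser V (zmx_mul A f)]wserM !mulrA.
have SdP : supp (@negz N) (mapU V d1 P).
  by rewrite -[mapU V d1 P]subr0 -d11 -mapUB; apply: SV.
have SP0 : supp (@negz N) (mapU V (ev 0) P - 1).
  by rewrite -(mapU1 U V (ev 0)) -mapUB; apply: SV.
have dPsiE := wave_variation (mulmxV uA) (supp_expz1 V) SP0 (SV (ev 0) _ _ SPsi) P0E
  (PhiPsi_e 0) SdP (SV d1 _ _ SPsi) dPsi.
rewrite -(zcoef_tower_variation l_gt0 (SV (ev 0) _ _ SPsi) (SV (ev 0) _ _ SPhi) (PhiPsi_e 0) dPsiE dPhiE).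
rewrite /tower_sum mapT_sum; apply: eq_bigr => i _.
by rewrite !zcoef_mapU; apply: (mapT_leibniz L).
Qed.

End Main.

(** Multiplying the tower by [(-1)^(a + 1)] turns the alternating coefficients of
    the [g_+]-action into those of [tower_variation], up to [(-1)^(l + 1)]. *)
Lemma gplus_action_sign (N : nat) (C : numFieldType) (M t : nat -> nat -> tmx N C)
    (l : nat) (r : 'M[C]_N) a b :
  (forall a b, M a b = (-1) ^+ a.+1 *: t a b) ->
  (-1) ^+ l.+1 *: gplus_action M l r a b = (-1) ^+ a.+1 *:
    (- (tmx_const r *m t (a + l)%N b) + t a (b + l)%N *m tmx_const r
     + \sum_(i < l) t a i *m tmx_const r *m t (l - 1 - i)%N b).
Proof.
move=> Mt; have sgn p q : odd p = odd q -> (-1) ^+ p = (-1) ^+ q :> fps N C.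
  by move=> pq; rewrite -signr_odd pq signr_odd.
rewrite /gplus_action !Mt !scalerDr !scalerN; congr (_ + _ + _).
- rewrite -scaleNr -[- (_ ^+ _)]mulN1r -exprS -scalemxAr scalerA -exprD; congr (_ *: _).
  by apply: sgn; lia.
- rewrite -scalemxAl !scalerA -!exprD -scaleNr -[- (_ ^+ _)]mulN1r -exprS; congr (_ *: _).
  by apply: sgn; lia.
rewrite !scaler_sumr; apply: eq_bigr => i _; have il := ltn_ord i.
rewrite !Mt -!scalemxAl -scalemxAr !scalerA -!exprD; congr (_ *: _); apply: sgn.
lia.
Qed.

Theorem theorem6p4 (l : nat) (hl : (0 < l)%N) :
  exists s : int, (s = 1 \/ s = -1) /\
    forall (R : realType) (N : nat) (A : nat -> 'M[R[i]]_N)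
           (hA : A 0%N \in unitmx) (r : 'M[R[i]]_N) (a b : nat),
      (forall (m : mono N) (i j : 'I_N),
          derivable (tower_orbit A (zmx_monom l r) a b m i j) 0 1) /\
      tower_action A (zmx_monom l r) a b =
        s%:~R *: gplus_action (tower A) l r a b.
Proof.
exists ((-1) ^+ l.+1); split.
  by rewrite -signr_odd; case: (odd _); [right | left].
move=> R N A hA r a b.
have [W [psi [phi [orbitW towerA dW]]]] := tower_first_order r hA hl.
have orbitE m i j : tower_orbit A (zmx_monom l r) a b m i j =
    horner (coef (W a b i j) m).
  by apply/funext => e; rewrite /tower_orbit orbitW !mxE /= !mxE.
split=> [m i j|]; first by rewrite orbitE; case: (derive1_horner0 (coef (W a b i j) m)).
have -> : tower_action A (zmx_monom l r) a b = mapT (coefp 1) (W a b).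
  apply/matrixP => i j; apply/fpsP => m; rewrite !mxE /= orbitE.
  by rewrite (derive1_horner0 _).2 !mxE.
by rewrite dW rmorphXn rmorphN1 (gplus_action_sign _ _ _ _ towerA).
Qed.
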